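(* Let $0\le k\le n$ and let $D$ be an $n$-diagram having no link joining two of the $k$ leftmost bottom vertices and no link joining two of the $n-k$ rightmost bottom vertices. Let $I_0$ be the unique element of $T(D)$ with $\operatorname{sgn}(I_0)=1$, and let $w\in W^J$ be the element with $\widetilde{Seq}^{-1}(v_{I_0})=M_w$. Then the canonical basis element of $\mathcal M$ with first term $\widetilde{Seq}^{-1}(v_{I_0})$, i.e. $\underline M_w$, is equal to $$\sum_{I\in T(D)}\operatorname{sgn}(I)\,\widetilde{Seq}^{-1}(v_I).$$
   Context: Let $q$ be an indeterminate, $\mathbb K=\mathbb C(q)$, and let $a\mapsto\bar a$ be the $\mathbb C$-linear field automorphism of $\mathbb K$ with $\bar q=q^{-1}$. Hecke algebra and spherical module. $W=S_n$ with simple reflections $s_i=(i\ i+1)$ and length function $\ell$. $\mathcal H$ is the $\mathbb K$-algebra with basis $H_x$ ($x\in W$), $H_xH_y=H_{xy}$ if $\ell(xy)=\ell(x)+\ell(y)$, and $H_xH_s=H_{xs}+(q^{-1}-q)H_x$ if $\ell(xs)=\ell(x)-1$, for $s$ simple. The bar involution of $\mathcal H$ is the antilinear ring involution with $\overline{H_x}=(H_{x^{-1}})^{-1}$. Let $J=\{s_1,\dots,s_{n-1}\}\setminus\{s_k\}$, $W_J=S_k\times S_{n-k}$ the subgroup generated by $J$, $\mathcal H_J\subseteq\mathcal H$ the corresponding subalgebra, and $W^J$ the set of minimal-length representatives of the cosets $wW_J$. $\mathcal M=\mathcal H\otimes_{\mathcal H_J}\mathbb K_{\mathrm{triv}}$,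 where $H_s$ ($s\in J$) acts on $\mathbb K_{\mathrm{triv}}$ by $q^{-1}$. It has standard basis $M_x=H_x\otimes 1$ ($x\in W^J$) and bar involution $\overline{h\otimes1}=\bar h\otimes1$. The canonical basis element $\underline M_x$ is the unique bar-invariant element of $M_x+\sum_{y\in W^J}q^{-1}\mathbb Z[q^{-1}]M_y$. Diagrams. An $n$-diagram consists of two parallel horizontal lines (bottom and top) with $n$ vertices each, the $2n$ vertices being joined in pairs by pairwise non-crossing edges (''links'') drawn between the lines, up to homotopy. $V=\mathbb K v_+\oplus\mathbb K v_-$, and $V^{\otimes n}_k$ is the span of the standard basis vectors of $V^{\otimes n}$ having exactly $k$ components $v_-$ and $n-k$ components $v_+$. Number the vertices of both lines of $D$, and the tensor components of $V^{\otimes n}$ used in defining $v_I$, by $1,\dots,n$ from RIGHT to LEFT. Let $C(D)$ be the set of two-element subsets $\{i,j\}\subseteq\{1,\dots,n\}$ such that the top vertices $i$ and $j$ are joined by a link of $D$, and let $m=|C(D)|$. $T(D)$ is the set of $m$-element subsets $S\subseteq\{1,\dots,n\}$ with $|S\cap C|=1$ for every $C\in C(D)$. For $S\in T(D)$, $\operatorname{sgn}(S)=(-q^{-1})^{c(S)}$, where $c(S)=|\{C\in C(D): S\cap C=\{\min C\}\}|$. For $I\in T(D)$, $v_I\in V^{\otimes n}_k$ is the standard basis vector defined as follows: if a link of $D$ joins a bottom vertex to the top vertex $j$, the $j$th component of $v_I$ is $v_-$ if that bottom vertex is among the $k$ leftmost bottom vertices and $v_+$ otherwise; every other component $i$ is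 $v_+$ if $i\in I$ and $v_-$ otherwise. The linear isomorphism $\widetilde{Seq}^{-1}:V^{\otimes n}_k\to\mathcal M$ sends a standard basis vector whose components equal to $v_-$ are in positions $a_1<\dots<a_k$, counted from LEFT to right, to $M_w$ with $$w=(s_{a_1-1}s_{a_1-2}\cdots s_1)\cdots(s_{a_{k-1}-1}s_{a_{k-1}-2}\cdots s_{k-1})(s_{a_k-1}s_{a_k-2}\cdots s_k).$$ *)

(* Defs.v *)
From HB Require Import structures.
From mathcomp Require Import all_boot all_order all_algebra all_fingroup.
From mathcomp Require Import falgebra.

Set Implicit Arguments.
Unset Strict Implicit.
Unset Printing Implicit Defensive.

Import GRing.Theory.
Local Open Scope ring_scope.

(** * The Coxeter group [S_n] *)

(* The product of 'S_n composes from left to right.  All notions below depend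
   only on the Coxeter system, so the opposite convention (which is isomorphic
   to this one through inversion, fixing the simple reflections) would give the
   same objects. *)

(* [sref n i] exchanges the i-th and (i+1)-st of the n points, counted from 1;
   the value for i outside 1 .. n-1 is irrelevant. *)
Definition sref (n i : nat) : 'S_n :=
  if (insub i.-1, insub i) is (Some a, Some b) then tperm a b else 1%g.

Definition simple (n : nat) : {set 'S_n} :=
  [set sref n i | i : 'I_n & (0 < i)%N].

Definition is_word (n : nat) (x : 'S_n) (m : nat) : bool :=
  [exists t : m.-tuple 'S_n,
     all (fun s => s \in simple n) t && (x == \prod_(s <- t) s)%g].

Lemma srefE n (a b : 'I_n) : b = a.+1 :> nat -> sref n b = tperm a b.
Proof.
move=> eb; rewrite /sref eb /= insubT // => lta.
rewrite insubT -?eb // => ltb.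
by congr tperm; apply: val_inj.
Qed.

Lemma gen_simple n : <<simple n>>%g = [set: 'S_n].
Proof.
case: n => [|n].
  apply/eqP; rewrite eqEsubset subsetT /=; apply/subsetP => x _.
  by have -> : x = 1%g by [apply/permP; case]; exact: group1.
apply/eqP; rewrite eqEsubset subsetT /= -(gen_tperm ord0) gen_subG.
apply/subsetP => _ /imsetP[[y lty] _ ->].
elim: y lty => [|y IHy] lty.
  by rewrite (_ : Ordinal lty = ord0) ?tperm1 ?group1 //; apply: val_inj.
have lty' : (y < n.+1)%N by apply: ltnW.
have Sy : tperm (Ordinal lty') (Ordinal lty) \in <<simple n.+1>>%g.
  rewrite -(@srefE _ (Ordinal lty') (Ordinal lty)) //; apply: mem_gen.
  by apply/imsetP; exists (Ordinal lty); rewrite ?inE.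
case: y IHy lty lty' Sy => [|y] IHy lty lty' Sy.
  by have -> : ord0 = Ordinal lty' by [apply: val_inj]; exact: Sy.
have := groupJ (IHy lty') Sy; rewrite tpermJ tpermL tpermD //.
Qed.

Lemma word_exists n (x : 'S_n) : exists m, is_word x m.
Proof.
have : x \in <<simple n>>%g by rewrite gen_simple inE.
case/gen_prodgP => m [c Sc ->]; exists m; apply/existsP.
exists [tuple c i | i < m]; rewrite big_tuple; apply/andP; split.
  by apply/allP => _ /tnthP[i ->]; rewrite tnth_mktuple.
by apply/eqP; apply: eq_bigr => i _; rewrite tnth_mktuple.
Qed.

Definition len (n : nat) (x : 'S_n) : nat := ex_minn (word_exists x).

Definition simpleJ (n k : nat) : {set 'S_n} :=
  [set sref n i | i : 'I_n & (0 < i)%N && (val i != k)].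

Definition WJ (n k : nat) : {group 'S_n} := <<simpleJ n k>>%G.

Definition minrep (n k : nat) : {set 'S_n} :=
  [set x | [forall u in WJ n k, (len x <= len (x * u)%g)%N]].

(** * The Hecke algebra and its spherical module *)

Notation ratfun C := {fraction {poly C}}.

Definition qvar (C : fieldType) : ratfun C := FracField.tofrac 'X.
Arguments qvar {C}.

Definition ratconst (C : fieldType) (c : C) : ratfun C :=
  FracField.tofrac c%:P.

Record is_bar (C : fieldType) (bar : {rmorphism ratfun C -> ratfun C}) :
    Prop := IsBar {
  bar_bij : bijective bar;
  bar_linear : forall c x, bar (ratconst c * x) = ratconst c * bar x;
  bar_q : bar qvar = qvar^-1
}.

Record is_hecke_basis (C : fieldType) (n : nat) (H : falgType (ratfun C))
    (T : 'S_n -> H) : Prop := IsHeckeBasis {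
  hecke_basis : basis_of fullv [seq T x | x : 'S_n];
  hecke_mul : forall x y, len (x * y)%g = (len x + len y)%N ->
    T x * T y = T (x * y)%g;
  hecke_mul_simple : forall x s, s \in simple n ->
    len x = (len (x * s)%g).+1 ->
    T x * T s = T (x * s)%g + (qvar^-1 - qvar) *: T x
}.

Record is_hecke_bar (C : fieldType) (n : nat)
    (bar : {rmorphism ratfun C -> ratfun C}) (H : falgType (ratfun C))
    (T : 'S_n -> H) (barH : {rmorphism H -> H}) : Prop := IsHeckeBar {
  hecke_barK : involutive barH;
  hecke_bar_antilinear : forall a h, barH (a *: h) = bar a *: barH h;
  hecke_bar_basis : forall x, barH (T x) = (T x^-1%g)^-1
}.

Definition heckeJ (C : fieldType) (n k : nat) (H : falgType (ratfun C))
    (T : 'S_n -> H) : {aspace H} :=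
  << <<[seq T s | s in simpleJ n k]>> >>%AS.

(* [act] is the action of the subalgebra on its module K_triv, whose
   underlying vector space is K; its values outside [heckeJ] are irrelevant. *)
Record is_triv_action (C : fieldType) (n k : nat) (H : falgType (ratfun C))
    (T : 'S_n -> H) (act : H -> ratfun C -> ratfun C) : Prop := IsTrivAction {
  triv_addr : forall b, b \in heckeJ k T -> {morph act b : c d / c + d};
  triv_addl : forall b b' c, b \in heckeJ k T -> b' \in heckeJ k T ->
    act (b + b') c = act b c + act b' c;
  triv_mul : forall b b' c, b \in heckeJ k T -> b' \in heckeJ k T ->
    act (b * b') c = act b (act b' c);
  triv_scalar : forall a c, act a%:A c = a * c;
  triv_simple : forall s c, s \in simpleJ n k -> act (T s) c = qvar^-1 * c
}.

Record balanced (A : nzRingType) (B : {pred A}) (N Z : zmodType)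
    (act : A -> N -> N) (f : A -> N -> Z) : Prop := Balanced {
  balanced_addl : forall a a' x, f (a + a') x = f a x + f a' x;
  balanced_addr : forall a x x', f a (x + x') = f a x + f a x';
  balanced_act : forall a b x, b \in B -> f (a * b) x = f a (act b x)
}.

(* [M], with [t a x] in the role of the pure tensor of a and x, is the left
   [A]-module obtained by tensoring [A] over the subring [B] with the left
   [B]-module [N] whose action is [act]. *)
Record is_tensor (A : nzRingType) (B : {pred A}) (N : zmodType)
    (act : A -> N -> N) (M : lmodType A) (t : A -> N -> M) : Prop := IsTensor {
  tensor_balanced : balanced B act t;
  tensor_scale : forall a a' x, a *: t a' x = t (a * a') x;
  tensor_lift : forall (Z : zmodType) (f : A -> N -> Z), balanced B act f ->
    exists g : {additive M -> Z}, forall a x, g (t a x) = f a x;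
  tensor_ext : forall (Z : zmodType) (g g' : {additive M -> Z}),
    (forall a x, g (t a x) = g' (t a x)) -> g =1 g'
}.

Definition stdM (C : fieldType) (n : nat) (H : falgType (ratfun C))
    (T : 'S_n -> H) (M : lmodType H) (t : H -> ratfun C -> M) (x : 'S_n) : M :=
  t (T x) 1.

Definition in_qinvZ (C : fieldType) (c : ratfun C) : Prop :=
  exists p : {poly int}, c = qvar^-1 * (map_poly intr p).[qvar^-1].

(* [M] is a module over the ring [H]; a scalar [a] of the ground field acts on
   it as the element [a%:A] of [H]. *)
Definition is_canonical (C : fieldType) (n k : nat) (H : falgType (ratfun C))
    (T : 'S_n -> H) (M : lmodType H) (t : H -> ratfun C -> M) (barM : M -> M)
    (w : 'S_n) (X : M) : Prop :=
  barM X = X /\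
  exists2 c : 'S_n -> ratfun C,
    forall y, y \in minrep n k -> in_qinvZ (c y) &
    X = stdM T t w + \sum_(y in minrep n k) ((c y)%:A : H) *: stdM T t y.

(** * Diagrams *)

(* The n vertices of either line are indexed by ['I_n] from RIGHT to LEFT
   (index i is the vertex numbered i+1); bottom vertices are [inl], top
   vertices are [inr]. *)
Definition vertex (n : nat) : Type := ('I_n + 'I_n)%type.

(* Position along the boundary of the strip: the bottom line from right to
   left, followed by the top line from left to right. *)
Definition bdpos (n : nat) (v : vertex n) : nat :=
  match v with inl i => i | inr j => (n + (n - j.+1))%N end.

(* Up to homotopy a diagram is determined by the matching of its vertices, and
   a matching can be drawn without crossings in the strip if and only if no two
   of its pairs are interlaced along the boundary. *)
Record diagram (n : nat) := Diagram {
  link : vertex n -> vertex n;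
  linkK : involutive link;
  link_neq : forall v, link v <> v;
  link_noncrossing : forall u v,
    ~~ [&& bdpos u < bdpos v, bdpos v < bdpos (link u)
         & bdpos (link u) < bdpos (link v)]%N
}.

Definition leftmost (n k : nat) (b : 'I_n) : bool := (n - k <= b)%N.

Definition admissible (n k : nat) (D : diagram n) : Prop :=
  forall b b' : 'I_n, link D (inl b) = inl b' -> leftmost k b != leftmost k b'.

Definition top_links (n : nat) (D : diagram n) : {set {set 'I_n}} :=
  [set L | [exists i, exists j,
     (L == [set i; j]) && (link D (inr i) == inr j)]].

Definition transversals (n : nat) (D : diagram n) : {set {set 'I_n}} :=
  [set S : {set 'I_n} | (#|S| == #|top_links D|)
           && [forall L in top_links D, #|S :&: L| == 1%N]].

Definition cnt (n : nat) (D : diagram n) (S : {set 'I_n}) : nat :=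
  #|[set L : {set 'I_n} in top_links D |
      [exists i in L, [forall j in L, (i <= j)%N] && (S :&: L == [set i])]]|.

Definition sgn (C : fieldType) (n : nat) (D : diagram n) (S : {set 'I_n}) :
    ratfun C := (- qvar^-1) ^+ cnt D S.

(** * Tensor space *)

(* A standard basis vector of the n-th tensor power of V is encoded by the
   function telling for which components, indexed from RIGHT to LEFT, it has
   v_- ; the tensor power is the space of functions on these. *)
Definition state (n : nat) := {ffun 'I_n -> bool}.

Definition tensV (C : fieldType) (n : nat) := {ffun state n -> (ratfun C)^o}.

Definition stdV (C : fieldType) (n : nat) (e : state n) : tensV C n :=
  [ffun e' => (e' == e)%:R].

Definition vstate (n k : nat) (D : diagram n) (I : {set 'I_n}) : state n :=
  [ffun j => match link D (inr j) with
             | inl b => leftmost k b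
             | inr _ => j \notin I
             end].

Definition vI (C : fieldType) (n k : nat) (D : diagram n) (I : {set 'I_n}) :
    tensV C n := stdV C (vstate k D I).

(* The increasing list of the positions of the v_- , counted from 1 and from
   LEFT to right; component [i] from the right is at position [n - i]. *)
Definition minus_positions (n : nat) (e : state n) : seq nat :=
  sort leq [seq (n - val i)%N | i <- enum 'I_n & e i].

Definition seq_perm (n k : nat) (e : state n) : 'S_n :=
  (\prod_(1 <= j < k.+1)
    \prod_(i <- rev (index_iota j (nth 0 (minus_positions e) j.-1)))
      sref n i)%g.

(* The linear map is meant on the span of the basis vectors having exactly [k]
   components v_- ; it is extended by zero to the other basis vectors. *)
Definition Seq_inv (C : fieldType) (n k : nat) (H : falgType (ratfun C))
    (T : 'S_n -> H) (M : lmodType H) (t : H -> ratfun C -> M)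
    (v : tensV C n) : M :=
  \sum_(e : state n | #|[set i | e i]| == k)
    ((v e : ratfun C)%:A : H) *: stdM T t (seq_perm k e).

(* Main.v *)
Require Import Defs.
From HB Require Import structures.
From mathcomp Require Import all_boot all_order all_algebra all_fingroup.
From mathcomp Require Import falgebra ring zify reals complex.

(** Read a word of signs as a word of parentheses, + opening and - closing, and
    attach to it the vector X which is the tensor product of a cup vector
    (+,-) - q^-1 (-,+) for every matched pair and of the unmatched signs
    ([canon]).  Two facts carry the proof.

    The vector X of every word e with k minuses is bar-invariant in the
    spherical module ([bar_canon]).  The element T_s - q^-1 of the Hecke algebra
    is bar-invariant, and it acts on sign words as the Temperley-Lieb generator
    made of a cap followed by a cup ([cap_Seq_inv]).  If e has +- at two
    adjacent places exchanged by s, these two places are matched, and the vector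
    of e is obtained by applying this generator to the vector of the word where
    they are exchanged ([canon_capcup]): all that happens is that a zigzag is
    straightened.  Repeating this leads to the word without any + before a -,
    whose vector is M_1.

    The signed sum over the transversals of D is the vector X of the word of I0
    ([prod_link_factor], [canon_link_factor]).  Expanding a product of cup
    vectors amounts to choosing the end of each link that carries +, that is a
    transversal, so the only point is that the links of D are the matching of
    parentheses of the word of I0.  This is planarity, together with the fact
    that by admissibility the through links labelled - lie to the left of those
    labelled +.

    Every transversal other than I0 has a sign in q^-1 Z[q^-1], so the sum has
    the shape required of a canonical basis element.  Such an element is unique
    because the bar involution is unitriangular for the length ([barH_lower])
    and because 0 is the only bar-invariant element of q^-1 Z[q^-1]
    ([bar_qinvZ], [bar_lin_indep]).  That the M_x are linearly independent is
    seen on explicit linear forms, one for each coset of W_J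
    ([coset_functional]), which descend to the tensor product by its universal
    property.

    On the side of the symmetric group, the length is the number of inversions,
    and the minimal coset representatives are the permutations that increase
    both on the places with value below k and on the others ([minrepP]). *)

Set Implicit Arguments.
Unset Strict Implicit.
Unset Printing Implicit Defensive.

Import GRing.Theory.

(** * Length and inversions *)

Lemma simple_tperm n (s : 'S_n) : s \in simple n ->
  exists a b : 'I_n, b = a.+1 :> nat /\ s = tperm a b.
Proof.
case/imsetP=> b; rewrite inE => b0 ->.
have ha : (b.-1 < n)%N by apply: leq_ltn_trans (leq_pred b) (ltn_ord b).
have eb : b = (Ordinal ha).+1 :> nat by rewrite /= prednK.
by exists (Ordinal ha), b; rewrite -srefE.
Qed.

Lemma tperm_simple n (a b : 'I_n) : b = a.+1 :> nat -> tperm a b \in simple n.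
Proof.
move=> eb; apply/imsetP; exists b; first by rewrite inE eb.
by rewrite (srefE eb).
Qed.

Lemma tperm_simpleJ n k (a b : 'I_n) : b = a.+1 :> nat -> (b != k :> nat) ->
  tperm a b \in simpleJ n k.
Proof.
move=> eb bk; apply/imsetP; exists b; last by rewrite (srefE eb).
by rewrite inE bk eb.
Qed.

Lemma simpleJ_tperm n k (s : 'S_n) : s \in simpleJ n k ->
  exists a b : 'I_n, [/\ b = a.+1 :> nat, b != k :> nat & s = tperm a b].
Proof.
case/imsetP=> b; rewrite inE => /andP[b0 bk] ->.
have ha : (b.-1 < n)%N by apply: leq_ltn_trans (leq_pred b) (ltn_ord b).
have eb : b = (Ordinal ha).+1 :> nat by rewrite /= prednK.
by exists (Ordinal ha), b; rewrite -srefE.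
Qed.

Definition inversions n (x : 'S_n) : {set 'I_n * 'I_n} :=
  [set p : 'I_n * 'I_n | (p.1 < p.2)%N && (x p.2 < x p.1)%N].

Lemma adjacent_tperm_lt n (a b i j : 'I_n) : b = a.+1 :> nat ->
  (i < j)%N -> (i, j) != (a, b) -> (tperm a b i < tperm a b j)%N.
Proof.
move=> eb ltij; rewrite xpair_eqE negb_and -!val_eqE /= => ne.
have val_neq (u v : 'I_n) : u <> v -> u <> v :> nat by move=> h /val_inj.
case: tpermP => [ei|ei|/val_neq ia /val_neq ib];
  case: tpermP => [ej|ej|/val_neq ja /val_neq jb]; rewrite ?ei ?ej in ltij ne *; lia.
Qed.

(** Exchanging two adjacent places permutes the inversions, apart from the pair
    of these places, which becomes an inversion. *)
Lemma card_inversions_tperm n (a b : 'I_n) (x : 'S_n) :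
  b = a.+1 :> nat -> (x a < x b)%N ->
  #|inversions (tperm a b * x)%g| = #|inversions x|.+1.
Proof.
move=> eb ltx; set s := tperm a b.
pose f (p : 'I_n * 'I_n) := (s p.1, s p.2).
have fK : cancel f f by case=> i j; rewrite /f /= !tpermK.
have -> : inversions (s * x)%g = (a, b) |: f @: inversions x.
  apply/setP=> [[i j]]; rewrite !inE /= !permM.
  have [[-> ->]|nij] := eqVneq (i, j) (a, b).
    by rewrite /s tpermL tpermR ltx eb ltnSn.
  rewrite -[(i, j)]fK (mem_imset _ _ (can_inj fK)) inE /=.
  have [ltij|leji] := ltnP i j; first by rewrite adjacent_tperm_lt.
  have [ltss|//] := ltnP (s i) (s j).
  have := adjacent_tperm_lt eb ltss.
  rewrite -/s !tpermK (leq_gtF leji); case: eqP => [|_ /(_ isT)//] [ei ej] _. 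
  by rewrite ei ej /= ltnNge ltnW.
rewrite cardsU1 card_imset; last exact: can_inj fK.
suff -> : (a, b) \notin f @: inversions x by [].
apply/imsetP=> [[[i j]]]; rewrite inE /= => /andP[ltij _] [ei ej].
move: ltij; rewrite -(tpermK a b i) -(tpermK a b j) -/s -ei -ej.
by rewrite tpermL tpermR eb ltnNge leqnSn.
Qed.

Lemma card_inversionsV n (x : 'S_n) : #|inversions x^-1%g| = #|inversions x|.
Proof.
pose f (y : 'S_n) (p : 'I_n * 'I_n) := (y p.2, y p.1).
have fK y : cancel (f y) (f y^-1%g) by case=> i j; rewrite /f /= !permK.
have le (y : 'S_n) : (#|inversions y| <= #|inversions y^-1%g|)%N.
  rewrite -(card_imset (inversions y) (can_inj (fK y))); apply: subset_leq_card.
  apply/subsetP=> _ /imsetP[[i j] + ->]; rewrite inE /= => /andP[ltij lty].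
  by rewrite inE /= !permK lty.
by apply/eqP; rewrite eqn_leq le -{2}(invgK x) le.
Qed.

Lemma increasing_perm1 n (x : 'S_n) :
  (forall a b : 'I_n, b = a.+1 :> nat -> (x a < x b)%N) -> x = 1%g.
Proof.
move=> inc.
have mono (i j : 'I_n) : (i < j)%N -> (x i < x j)%N.
  case: j => j; elim: j => // j IHj ltj; rewrite /= ltnS leq_eqVlt.
  have ltj' := ltnW ltj; have step := inc (Ordinal ltj') (Ordinal ltj) erefl.
  case/orP=> [/eqP eij | /(IHj ltj') lti]; last exact: ltn_trans lti step.
  by rewrite (_ : i = Ordinal ltj') //; apply: val_inj.
have ge (y : 'S_n) : (forall i j : 'I_n, i < j -> y i < y j)%N ->
    forall i : 'I_n, (i <= y i)%N.
  move=> my [i lti]; elim: i lti => // i IHi lti /=.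
  by apply: leq_ltn_trans (IHi (ltnW lti)) (my _ _ _).
apply/permP=> i; rewrite perm1; apply/val_inj/eqP.
rewrite eqn_leq (ge x mono) andbT leqNgt; apply/negP=> lti.
have ltV (u v : 'I_n) : (u < v)%N -> (x^-1%g u < x^-1%g v)%N.
  move=> ltuv; rewrite ltnNge leq_eqVlt; apply/negP => /orP[/eqP/val_inj|].
    by move/perm_inj=> e; rewrite e ltnn in ltuv.
  by move/mono; rewrite !permKV; move: ltuv; lia.
by have := ltV _ _ lti; rewrite permK; have := ge _ ltV i; lia.
Qed.

Lemma is_word_mul n (s x : 'S_n) m :
  s \in simple n -> is_word x m -> is_word (s * x)%g m.+1.
Proof.
move=> Ss /existsP[u /andP[Su /eqP->]]; apply/existsP; exists [tuple of s :: u].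
by rewrite /= Ss Su big_cons eqxx.
Qed.

Lemma perm_descent n (x : 'S_n) : x != 1%g ->
  exists a b : 'I_n, b = a.+1 :> nat /\ (x b < x a)%N.
Proof.
move=> xn1; case: (pickP (fun p : 'I_n * 'I_n =>
    (p.2 == p.1.+1 :> nat) && (x p.2 < x p.1)%N)) => [[a b] /andP[/eqP]|noD].
  by exists a, b.
case/eqP: xn1; apply: increasing_perm1 => a b eb.
have := noD (a, b); rewrite /= eb eqxx /= => /negbT; rewrite -leqNgt leq_eqVlt.
by case/orP=> // /eqP/val_inj/perm_inj eab; rewrite eab in eb; lia.
Qed.

Lemma inversions1 n : inversions (1 : 'S_n)%g = set0.
Proof.
by apply/setP=> [[i j]]; rewrite !inE !perm1 /= ltnNge; case: ltngtP.
Qed.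

(** A descent of x gives a shorter permutation with one inversion less, and only
    the identity has no descent; conversely a factor changes the number of
    inversions by one. *)
Lemma len_inversions n (x : 'S_n) : len x = #|inversions x|.
Proof.
have word_inv r : forall y : 'S_n, #|inversions y| = r -> is_word y r.
  elim: r => [|r IHr] y yr.
    apply/existsP; exists [tuple]; rewrite big_nil /=.
    have [_|/perm_descent[a [b [eb ltx]]]] := eqVneq y 1%g; first by [].
    by have := card0_eq yr (a, b); rewrite inE /= ltx eb ltnSn.
  have [y1|/perm_descent[a [b [eb ltx]]]] := eqVneq y 1%g.
    by move: yr; rewrite y1 inversions1 cards0.
  have y's : y = (tperm a b * (tperm a b * y))%g by rewrite mulgA tperm2 mul1g.
  have lt' : ((tperm a b * y)%g a < (tperm a b * y)%g b)%N.
    by rewrite !permM tpermL tpermR.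
  have := card_inversions_tperm eb lt'; rewrite -y's yr => -[/esym/IHr wd].
  by rewrite y's is_word_mul ?tperm_simple.
rewrite /len; case: ex_minnP => m wordm minm; apply/eqP; rewrite eqn_leq.
rewrite (minm _ (word_inv _ _ erefl)) /=.
case/existsP: wordm => u /andP[Su /eqP->] {x minm word_inv}.
rewrite -{2}(size_tuple u); elim: (tval u) Su => [_|s v IHv /=].
  by rewrite big_nil inversions1 cards0.
case/andP=> /simple_tperm[a [b [eb ->]]] /IHv; rewrite big_cons.
move: (\prod_(_ <- _) _)%g => x lex.
have [ltx|gtx|/val_inj/perm_inj eab] := ltngtP (x a) (x b); last 1 first.
- by rewrite eab in eb; lia.
- by rewrite card_inversions_tperm.
have lt' : ((tperm a b * x)%g a < (tperm a b * x)%g b)%N.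
  by rewrite !permM tpermL tpermR.
have := card_inversions_tperm eb lt'; rewrite mulgA tperm2 mul1g.
by move=> e; move: lex; rewrite e => /ltnW/leqW.
Qed.

Lemma len1 n : len (1 : 'S_n)%g = 0%N.
Proof. by rewrite len_inversions inversions1 cards0. Qed.

Lemma len_eq0 n (x : 'S_n) : len x = 0%N -> x = 1%g.
Proof.
move=> x0; apply/eqP/negPn/negP=> /perm_descent[a [b [eb ltx]]].
rewrite len_inversions in x0.
by have := card0_eq x0 (a, b); rewrite inE /= ltx eb ltnSn.
Qed.

Lemma lenV n (x : 'S_n) : len x^-1%g = len x.
Proof. by rewrite !len_inversions card_inversionsV. Qed.

Lemma len_tpermM n (a b : 'I_n) (x : 'S_n) :
  b = a.+1 :> nat -> (x a < x b)%N -> len (tperm a b * x)%g = (len x).+1.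
Proof. by rewrite !len_inversions; apply: card_inversions_tperm. Qed.

Lemma len_tperm n (a b : 'I_n) : b = a.+1 :> nat -> len (tperm a b) = 1%N.
Proof.
by move=> eb; rewrite -[tperm a b]mulg1 len_tpermM ?len1 // !perm1 eb.
Qed.

Lemma len_simple n (s : 'S_n) : s \in simple n -> len s = 1%N.
Proof. by case/simple_tperm=> a [b [eb ->]]; exact: len_tperm. Qed.

Lemma simple_invol n (s : 'S_n) : s \in simple n -> (s * s)%g = 1%g.
Proof. by case/simple_tperm=> a [b [eb ->]]; rewrite tperm2. Qed.

Lemma simpleV n (s : 'S_n) : s \in simple n -> s^-1%g = s.
Proof. by case/simple_tperm=> a [b [eb ->]]; rewrite tpermV. Qed.

Lemma len_simpleM n (s x : 'S_n) : s \in simple n ->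
  len (s * x)%g = (len x).+1 \/ len x = (len (s * x)%g).+1.
Proof.
case/simple_tperm=> a [b [eb ->]].
have [ltx|gtx|/val_inj/perm_inj eab] := ltngtP (x a) (x b); last 1 first.
- by rewrite eab in eb; lia.
- by left; apply: len_tpermM.
right; rewrite -{1}[x]mul1g -(tperm2 a b) -mulgA len_tpermM //.
by rewrite !permM tpermL tpermR.
Qed.

Lemma len_Msimple n (s x : 'S_n) : s \in simple n ->
  len (x * s)%g = (len x).+1 \/ len x = (len (x * s)%g).+1.
Proof.
move=> Ss; rewrite -lenV -[len x]lenV invMg (simpleV Ss).
exact: len_simpleM.
Qed.

Lemma sub_simpleJ n k : simpleJ n k \subset simple n.
Proof.
apply/subsetP=> s /simpleJ_tperm[a [b [eb _ ->]]]; exact: tperm_simple.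
Qed.


(** * Minimal coset representatives *)

(** Right multiplication by W_J permutes the values below k among themselves, so
    this set stands for the coset of x. *)
Definition mset k n (x : 'S_n) : {set 'I_n} := [set i | (x i < k)%N].

(** The one-line description of the minimal coset representatives, see [minrepP]. *)
Definition grassmannian k n (x : 'S_n) : Prop :=
  forall i j : 'I_n, (i < j)%N -> (i \in mset k x) = (j \in mset k x) ->
  (x i < x j)%N.

(** A pair inverted by y has its two values on different sides of k, and on which
    side they lie depends only on the coset. *)
Lemma grass_inversions k n (y z : 'S_n) : grassmannian k y ->
  mset k z = mset k y -> inversions y \subset inversions z.
Proof.
move=> gy /setP ezy; apply/subsetP=> [[i j]]; rewrite !inE /=.
case/andP=> ltij lty; rewrite ltij /=; have := gy _ _ ltij.
move: (ezy i) (ezy j); rewrite !inE => <- <-; have := ezy i; have := ezy j.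
by rewrite !inE; lia.
Qed.

Lemma grass_min k n (y z : 'S_n) : grassmannian k y ->
  mset k z = mset k y -> (len y <= len z)%N.
Proof. by move=> *; rewrite !len_inversions subset_leq_card ?(@grass_inversions k). Qed.

(** Two such permutations have the same inversions, which determine a permutation. *)
Lemma grass_inj k n (y z : 'S_n) : grassmannian k y -> grassmannian k z ->
  mset k y = mset k z -> y = z.
Proof.
move=> gy gz eyz.
have einv : inversions y = inversions z.
  by apply/eqP; rewrite eqEsubset !(@grass_inversions k).
apply/eqP; rewrite eq_mulVg1; apply/eqP/increasing_perm1 => a b eb.
rewrite !permM.
set p := y^-1%g a; set r := y^-1%g b.
have yp : y p = a by rewrite permKV.
have yr : y r = b by rewrite permKV.
have [ltpr|ltrp|/val_inj epr] := ltngtP p r.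
- rewrite ltnNge leq_eqVlt; apply/negP=> /orP[/eqP/val_inj/perm_inj epr|ltz].
    by rewrite epr in ltpr; lia.
  have : (p, r) \in inversions z by rewrite inE ltpr.
  by rewrite -einv inE /= yp yr; lia.
- have : (r, p) \in inversions y by rewrite inE ltrp yp yr eb /=.
  by rewrite einv inE /= => /andP[].
- by move: yp yr; rewrite epr => -> eab; rewrite eab in eb; lia.
Qed.

Lemma mset_mulWJ k n (x u : 'S_n) : u \in WJ n k -> mset k (x * u)%g = mset k x.
Proof.
have pres : forall v, v \in simpleJ n k -> forall i, (v i < k)%N = (i < k)%N.
  move=> _ /simpleJ_tperm[a [b [eb bk ->]]] i.
  by case: tpermP => // ->; move: bk eb; lia.
case/gen_prodgP=> m [c Sc ->] {u}; elim: m c Sc => [|m IHm] c Sc.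
  by rewrite big_ord0 mulg1.
rewrite big_ord_recr mulgA -(IHm (fun i => c (widen_ord (leqnSn m) i))) //.
by apply/setP=> i; rewrite !inE !permM pres.
Qed.

(** If the values of one block do not come in increasing order, neither do two
    consecutive values of it, and exchanging these, a right multiplication by an
    element of W_J, shortens x. *)
Lemma minrepP k n (x : 'S_n) : reflect (grassmannian k x) (x \in minrep n k).
Proof.
rewrite inE; apply: (iffP forall_inP) => [minx|gx u Wu]; last first.
  by apply: (grass_min gx); apply: mset_mulWJ.
have step (a b : 'I_n) : b = a.+1 :> nat -> (b != k :> nat) ->
    (x^-1%g a < x^-1%g b)%N.
  move=> eb bk; rewrite ltnNge leq_eqVlt; apply/negP.
  case/orP=> [/eqP/val_inj/perm_inj eab|ltba]; first by rewrite eab in eb; lia.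
  have := minx _ (mem_gen (tperm_simpleJ eb bk)).
  rewrite leqNgt -(lenV (_ * _)) -(lenV x) invMg tpermV => /negP; apply.
  rewrite -ltnS -(len_tpermM eb); first by rewrite mulgA tperm2 mul1g.
  by rewrite !permM tpermL tpermR.
have chain (v w : 'I_n) : (v < w)%N -> (v < k)%N = (w < k)%N ->
    (x^-1%g v < x^-1%g w)%N.
  case: w => w; elim: w => // w IHw ltw; rewrite /= ltnS leq_eqVlt => lev ek.
  have ltw' := ltnW ltw.
  have bk : (Ordinal ltw != k :> nat) by move: lev ek => /=; lia.
  have stp := step (Ordinal ltw') (Ordinal ltw) erefl bk.
  case/orP: lev => [/eqP evw | ltv].
    by rewrite (_ : v = Ordinal ltw') //; apply: val_inj.
  apply: ltn_trans stp; apply: IHw => //=; move: ltv ek bk => /=; lia.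
move=> i j ltij; rewrite !inE => ek; rewrite ltnNge leq_eqVlt; apply/negP.
case/orP=> [/eqP/val_inj/perm_inj eab|/chain]; first by rewrite eab in ltij; lia.
by move=> /(_ (esym ek)); rewrite !permK; lia.
Qed.

(** * The permutation of a sign word *)

(** The factors of [seq_perm]. *)
Definition cycle_down n (j a : nat) : 'S_n :=
  (\prod_(i <- rev (index_iota j a)) sref n i)%g.

(** Places are counted from 0, the indices of the simple reflections from 1;
    hence the predecessors. *)
Lemma cycle_downE n (j a : nat) (p : 'I_n) : (0 < j <= a)%N -> (a <= n)%N ->
  cycle_down n j a p =
    (if p == a.-1 :> nat then j.-1
     else if (j.-1 <= p < a.-1)%N then p.+1 else p) :> nat.
Proof.
case/andP=> j0 /subnKC <-; move: (a - j)%N => d {a}.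
rewrite /cycle_down; elim: d p => [|d IHd] p len_n.
  by rewrite addn0 /index_iota subnn big_nil perm1; do ![case: ifP => //]; lia.
have ltb : (j + d < n)%N by lia.
have lta : ((j + d).-1 < n)%N by lia.
rewrite /index_iota addKn -[d.+1]addn1.
rewrite iotaD /= rev_cat big_cat /= big_seq1 permM.
have -> : sref n (j + d) = tperm (Ordinal lta) (Ordinal ltb).
  by rewrite -srefE //=; lia.
move: IHd; rewrite /index_iota addKn => IHd; rewrite IHd ?(ltnW ltb) //.
case: tpermP => [->|->|pa pb] /=.
- do ![case: ifP => //]; lia.
- do ![case: ifP => //]; lia.
have {}pa : p <> (j + d).-1 :> nat by move=> e; apply: pa; apply: val_inj.
have {}pb : p <> j + d :> nat by move=> e; apply: pb; apply: val_inj.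
by do ![case: ifP => //]; lia.
Qed.

Definition cycles_prod n (a : seq nat) (m : nat) : 'S_n :=
  (\prod_(1 <= j < m.+1) cycle_down n j (nth 0 a j.-1))%g.

Lemma cycles_prodS n a m :
  cycles_prod n a m.+1 = (cycles_prod n a m * cycle_down n m.+1 (nth 0 a m))%g.
Proof. by rewrite /cycles_prod big_nat_recr. Qed.

Lemma sorted_nth_gt (a : seq nat) m : sorted ltn a -> (0 < nth 0 a 0)%N ->
  (m < size a -> m < nth 0 a m)%N.
Proof.
move=> sa a0; elim: m => [//|m IHm] ltm.
apply: leq_ltn_trans (IHm (ltnW ltm)) _.
by rewrite (sorted_ltn_nth ltn_trans) ?inE // ltnW.
Qed.

(** The m-th factor brings the m-th entry of a, which the previous factors leave
    in place, to the place m; it fixes the smaller values, already attained on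
    the previous entries, and is increasing on the other ones. *)
Lemma cycles_prodP n (a : seq nat) m : sorted ltn a ->
  all (fun c => 0 < c <= n)%N a -> (m <= size a)%N ->
  [/\ forall (p : 'I_n) j, (j < m)%N -> p.+1 = nth 0 a j ->
        cycles_prod n a m p = j :> nat,
      forall p r : 'I_n, (p < r)%N ->
        p.+1 \notin take m a -> r.+1 \notin take m a ->
        (cycles_prod n a m p < cycles_prod n a m r)%N
    & forall p : 'I_n, (forall j, (j < m)%N -> (nth 0 a j <= p)%N) ->
        cycles_prod n a m p = p].
Proof.
move=> sa alla; elim: m => [_|m IHm ltm].
  rewrite /cycles_prod big_geq //; split=> // [p r|p _]; last exact: perm1.
  by rewrite !perm1.
have [I1 I2 I3] := IHm (ltnW ltm).
have /andP[a0 an] : (0 < nth 0 a m <= n)%N by apply: (allP alla); apply: mem_nth.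
have ma : (m < nth 0 a m)%N.
  apply: sorted_nth_gt => //; have := allP alla (nth 0 a 0) (mem_nth _ _).
  by case/(_ (leq_ltn_trans (leq0n _) ltm))/andP.
have lta j : (j < m)%N -> (nth 0 a j < nth 0 a m)%N.
  by move=> ltj; rewrite (sorted_ltn_nth ltn_trans) ?inE // (ltn_trans ltj).
have cE p := @cycle_downE n m.+1 (nth 0 a m) p ma an.
rewrite cycles_prodS (take_nth 0 ltm); split.
- move=> p j; rewrite ltnS leq_eqVlt => /orP[/eqP-> ep|ltj ep]; rewrite permM.
    by rewrite I3 ?cE -?ep ?eqxx // => i /lta; rewrite -ep ltnS.
  rewrite cE (I1 p j ltj ep); have := ma; do ![case: ifP => //]; lia.
- move=> p r ltpr; rewrite !mem_rcons !inE !negb_or => /andP[pm pt] /andP[rm rt].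
  rewrite !permM !cE; have := I2 p r ltpr pt rt.
  have am : ((nth 0 a m).-1 < n)%N by lia.
  have fixm : cycles_prod n a m (Ordinal am) = Ordinal am.
    by apply: I3 => j /lta /=; lia.
  have ne (q : 'I_n) : q.+1 != nth 0 a m ->
      cycles_prod n a m q <> (nth 0 a m).-1 :> nat.
    move=> qm e; move: qm; rewrite -[nth 0 a m]prednK // eqSS.
    case/eqP; rewrite -[RHS]/(val (Ordinal am)); congr val.
    by apply: (@perm_inj _ (cycles_prod n a m)); rewrite fixm; apply: val_inj.
  move: (ne p pm) (ne r rm); do ![case: ifP]; lia.
- move=> p lep; rewrite permM (I3 p) => [|j ltj]; last exact/lep/ltnW.
  apply: val_inj; rewrite /= cE; have := lep m (ltnSn m).
  by do ![case: ifP => //]; lia.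
Qed.

(** Places are counted from the left here, whereas states are indexed from the
    right; [rev_ord] passes from one to the other, here and below. *)
Definition minus_set n (e : state n) : {set 'I_n} := [set p | e (rev_ord p)].

Lemma mem_minus_positions n (e : state n) (p : 'I_n) :
  (p.+1 \in minus_positions e) = (p \in minus_set e).
Proof.
rewrite mem_sort inE; apply/mapP/idP => [[j]|ep].
  rewrite mem_filter => /andP[ej _] ep.
  suff -> : rev_ord p = j by [].
  by apply: ord_inj; move: ep (ltn_ord j) => /=; lia.
exists (rev_ord p); first by rewrite mem_filter ep mem_enum.
by rewrite /=; have := ltn_ord p; lia.
Qed.

(** The cycles send the k places with sign - to the values below k, in this order,
    and keep the order of the others. *)
Lemma seq_permP n k (e : state n) : #|[set i | e i]| = k ->
  grassmannian k (seq_perm k e) /\ mset k (seq_perm k e) = minus_set e.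
Proof.
move=> ek; set a := minus_positions e.
have sz : size a = k.
  rewrite size_sort size_map -ek cardE enumT /enum_mem !size_filter.
  by apply: eq_count => i; rewrite -[RHS]/(i \in [set j | e j]) inE.
have sa : sorted ltn a.
  rewrite ltn_sorted_uniq_leq sort_uniq; apply/andP; split; last first.
    exact/sort_sorted/leq_total.
  rewrite map_inj_uniq; first exact/filter_uniq/enum_uniq.
  move=> i j e'; apply: ord_inj.
  by move: e' (ltn_ord i) (ltn_ord j) => /=; lia.
have alla : all (fun c => 0 < c <= n)%N a.
  apply/allP=> c; rewrite mem_sort => /mapP[i _ ->]; have := ltn_ord i => /=; lia.
have [I1 I2 _] := cycles_prodP sa alla (leqnn _).
rewrite -/(cycles_prod n a k) -{}sz; move: I1 I2; rewrite take_size.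
set w := cycles_prod n a _ => I1 I2.
have ms : mset (size a) w = minus_set e.
  apply/setP=> p; rewrite -mem_minus_positions -/a inE; apply/idP/idP => [ltw|pa].
    have /andP[a0 an] := allP alla _ (mem_nth 0 ltw).
    have lta : ((nth 0 a (w p)).-1 < n)%N by rewrite prednK.
    have eq : (Ordinal lta).+1 = nth 0 a (w p) by rewrite /= prednK.
    have /val_inj/perm_inj <- := I1 (Ordinal lta) _ ltw eq.
    by rewrite eq mem_nth.
  by rewrite (I1 p (index p.+1 a)) ?nth_index ?index_mem.
split=> // i j ltij; rewrite ms -!mem_minus_positions -/a => eij.
have [ja|ja] := boolP (j.+1 \in a); last by apply: I2 => //; rewrite eij.
have ia : i.+1 \in a by rewrite eij.
rewrite (I1 i (index i.+1 a)) ?nth_index ?index_mem //.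
rewrite (I1 j (index j.+1 a)) ?nth_index ?index_mem //.
rewrite ltnNge; apply/negP=> le.
have := sorted_leq_nth leq_trans leqnn 0 (sub_sorted ltnW sa).
move/(_ (index j.+1 a) (index i.+1 a)); rewrite !inE !index_mem => /(_ ja ia le).
by rewrite !nth_index //; lia.
Qed.

Local Open Scope ring_scope.

(** * Matching of parentheses with a stack *)

Section Stack.
Variables (K : fieldType) (q : K).

(** The coefficient of (x,y), read from left to right, in the cup vector
    (+,-) - q^-1 (-,+); the sign - is encoded by [true]. *)
Definition arc_weight (x y : bool) : K :=
  if x == y then 0 else if x then - q^-1 else 1.

(** The coefficient of the word of the second components of w in the vector of
    the word of its first components.  The stack S holds the second components
    at the pending +.  An empty stack stands for an infinite reserve of +: a -
    that meets it has weight 1 if its second component is -, and 0 otherwise,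
    which is what an unmatched - requires. *)
Fixpoint stack_weight (S : seq bool) (w : seq (bool * bool)) : K :=
  match w with
  | [::] => (all negb S)%:R
  | (false, x) :: w' => stack_weight (x :: S) w'
  | (true, x) :: w' =>
      arc_weight (head false S) x * stack_weight (behead S) w'
  end.

Lemma stack_weight_rcons S w :
  stack_weight (rcons S false) w = stack_weight S w.
Proof.
elim: w S => [|[[] x] w IHw] S /=; first by rewrite all_rcons.
  by case: S => [|y S] /=; rewrite ?IHw // -(IHw [::]).
by rewrite -rcons_cons IHw.
Qed.

(** The Temperley-Lieb generator sends (x,x) to 0 and, for x <> y, (x,y) to
    (y,x) - c (x,y), where c is this coefficient. *)
Definition cap_coef (x : bool) : K := if x then q^-1 else q.

(** Straightening of a zigzag.  Reading +- leaves the stack as it is and yields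
    the weight of a cup.  Reading -+ replaces the top of the stack by the second
    entry of the pair, and the combination on the right-hand side only retains
    the terms where the new top equals the former one. *)
Lemma stack_weight_swap S u x y w : q != 0 ->
  stack_weight S (u ++ (false, x) :: (true, y) :: w) =
  if x == y then 0 else
    stack_weight S (u ++ (true, y) :: (false, x) :: w)
      - cap_coef x * stack_weight S (u ++ (true, x) :: (false, y) :: w).
Proof.
move=> q0; elim: u S => [|[[] z] u IHu] S /=; last 2 first.
- by rewrite IHu; case: ifP => _; ring.
- exact: IHu.
have tail0 : stack_weight (false :: behead S) w =
    if S is [::] then stack_weight S w else stack_weight (false :: behead S) w.
  by case: S => //=; exact: (stack_weight_rcons [::]).
case: S tail0 => [|z S] /= tail0; rewrite /arc_weight /cap_coef.
  by case: x; case: y; rewrite /= ?tail0; field.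
by case: x; case: y; case: z tail0 => /= _; field.
Qed.

Lemma stack_weight_false S w : all (fun p => ~~ p.1) w ->
  stack_weight S w = (all negb S && all (fun p => ~~ p.2) w)%:R.
Proof.
elim: w S => [|[[] x] w IHw] S //=; first by rewrite andbT.
by move/IHw->; rewrite /= andbCA andbA.
Qed.

(** When no + precedes a -, nothing is matched. *)
Lemma stack_weight_sorted w : pairwise (fun x y => y.1 ==> x.1) w ->
  stack_weight [::] w = (all (fun p => p.1 == p.2) w)%:R.
Proof.
elim: w => [//|[[] x] w IHw] /= /andP[le sw].
  by rewrite IHw // /arc_weight; case: x; rewrite ?mul0r ?mul1r.
have w0 : all (fun p : bool * bool => ~~ p.1) w.
  by apply: sub_all le => -[[]].
rewrite stack_weight_false //= andbT; case: x => //=.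
congr (nat_of_bool _)%:R; apply: eq_in_all => p /(allP w0).
by case: p => [[] []].
Qed.

Lemma natr_all (I : Type) (a : pred I) (s : seq I) :
  (all a s)%:R = \prod_(x <- s) (a x)%:R :> K.
Proof.
elim: s => [|x s IHs]; first by rewrite big_nil.
by rewrite big_cons -IHs /=; case: (a x); rewrite ?mul0r ?mul1r.
Qed.

Lemma enum_ord_splitE n (s1 s2 : seq 'I_n) (i : 'I_n) :
  s1 ++ i :: s2 = enum 'I_n -> forall p, (p \in s1) = (p < i)%N.
Proof.
move=> es p.
have : sorted ltn (map val (s1 ++ i :: s2)).
  by rewrite es val_enum_ord iota_ltn_sorted.
rewrite (sorted_pairwise ltn_trans) pairwise_map pairwise_cat pairwise_cons.
case/and4P=> /allrelP lt12 _ /allP lt2 _; apply/idP/idP => [ps|ltp].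
  by apply: lt12; rewrite ?inE ?eqxx.
have : p \in s1 ++ i :: s2 by rewrite es mem_enum.
rewrite mem_cat inE => /or3P[//|/eqP epi|/lt2 /=]; last by lia.
by rewrite epi ltnn in ltp.
Qed.

Section Arcs.
Variables (n : nat) (e f : 'I_n -> bool) (pt : 'I_n -> option 'I_n).
Hypothesis pt_sym : forall p r : 'I_n, pt p = Some r ->
  [/\ pt r = Some p, r != p & e p = (r < p)%N].
Hypothesis pt_nest : forall p r i : 'I_n, pt p = Some r -> (p < i < r)%N ->
  exists2 j, pt i = Some j & (p < j < r)%N.
Hypothesis pt_none : forall p r : 'I_n, pt p = None -> pt r = None -> (p < r)%N ->
  e r -> e p.

Let pending (s : seq 'I_n) (p : 'I_n) : bool :=
  ~~ e p && (if pt p is Some r then r \notin s else true).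

Let stack (s : seq 'I_n) : seq bool :=
  [seq f p | p <- rev s & pending s p].

Let closing (p : 'I_n) : K :=
  match pt p with
  | Some r => if (r < p)%N then arc_weight (f r) (f p) else 1
  | None => if e p then (f p == e p)%:R else 1
  end.

(** Once the places in s1 have been read, the stack consists of the pending +, the
    last one on top.  Planarity is used twice: the partner of a closing place is
    the last pending +, and nothing is pending at an unmatched -. *)
Lemma stack_weight_suffix s1 s2 : s1 ++ s2 = enum 'I_n ->
  stack_weight (stack s1) [seq (e p, f p) | p <- s2] =
  \prod_(p <- s2) closing p *
  \prod_(p | (pt p == None) && ~~ e p) (f p == e p)%:R.
Proof.
elim: s2 s1 => [|i s2 IHs2] s1 es.
  rewrite cats0 in es; rewrite /= big_nil mul1r /stack es all_map all_filter.
  rewrite all_rev natr_all big_enum /= [RHS]big_mkcond /=.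
  apply: eq_bigr => p _; rewrite /pending.
  case: (pt p) => [r|]; first by rewrite mem_enum /= andbF.
  by rewrite eqxx andbT; case: (e p); case: (f p).
have es' : rcons s1 i ++ s2 = enum 'I_n by rewrite cat_rcons.
have ms1 := enum_ord_splitE es.
rewrite big_cons -mulrA -(IHs2 _ es') /=.
(* by planarity, a + between the two ends of the arc closed at i is matched
   before i *)
have pend_between (p r : 'I_n) : pt i = Some r -> (r < i)%N -> (r < p < i)%N ->
    pending s1 p = false.
  move=> pti ltri /[dup] /andP[ltrp ltpi] ltp.
  have [ptr _ _] := pt_sym pti.
  have [j ptp /andP[_ ltji]] := pt_nest ptr ltp.
  by rewrite /pending ptp ms1 ltji andbF.
have pend_rcons (p : 'I_n) : (p < i)%N -> pt i <> Some p ->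
    pending (rcons s1 i) p = pending s1 p.
  move=> ltp nip; rewrite /pending; case ptp: (pt p) => [r|] //.
  rewrite mem_rcons inE negb_or; case: eqP => [eri|] //.
  by case: nip; rewrite -eri; have [->] := pt_sym ptp.
case ei: (e i); last first.
  have -> : closing i = 1.
    rewrite /closing; case pti: (pt i) => [r|]; last by rewrite ei.
    by have [_ _] := pt_sym pti; rewrite ei => <-.
  rewrite mul1r; congr stack_weight; rewrite /stack rev_rcons /=.
  have -> /= : pending (rcons s1 i) i.
    rewrite /pending ei; case pti: (pt i) => [r|] //.
    have [_ rni] := pt_sym pti; rewrite ei mem_rcons inE negb_or rni ms1.
    by move<-.
  congr (_ :: map f _); apply: eq_in_filter => p; rewrite mem_rev ms1 => ltp.
  rewrite pend_rcons // => pti; have [_ _] := pt_sym pti.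
  by rewrite ei ltp.
case pti: (pt i) => [r|].
  have [ptr _] := pt_sym pti; rewrite ei => /esym ltri.
  have [s1a [s1b es1]] : exists s1a s1b, s1 = s1a ++ r :: s1b.
    have : r \in s1 by rewrite ms1.
    by case/splitPr => s1a s1b; exists s1a, s1b.
  have er : e r = false by have [_ _ ->] := pt_sym ptr; rewrite ltnNge ltnW.
  have ms1a : forall p, (p \in s1a) = (p < r)%N.
    by apply: (@enum_ord_splitE _ _ (s1b ++ i :: s2)); rewrite -es es1 -catA.
  have ms1b (p : 'I_n) : p \in s1b -> (r < p < i)%N.
    move=> ps; have pi : (p < i)%N.
      by rewrite -ms1 es1 mem_cat inE ps !orbT.
    rewrite pi andbT ltnNge leq_eqVlt -ms1a; apply/negP.
    have : uniq s1 by have := enum_uniq 'I_n; rewrite -es cat_uniq => /and3P[].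
    rewrite es1 cat_uniq /= => /and3P[_ /norP[_ /hasPn no] /andP[nr _]].
    case/orP => [/eqP/val_inj epr|]; last exact/negP/no.
    by rewrite -epr ps in nr.
  have st1 : stack s1 = f r :: stack (rcons s1 i).
    rewrite /stack rev_rcons /= {2}/pending ei /=.
    rewrite es1 rev_cat rev_cons -cats1 -!catA !filter_cat -es1 /=.
    have -> : pending s1 r by rewrite /pending er ptr ms1 ltnn.
    have b0 : [seq p <- rev s1b | pending s1 p] = [::].
      apply/eqP; rewrite -[_ == _]negbK -has_filter; apply/hasPn => p.
      by rewrite mem_rev => /ms1b lp; rewrite (pend_between p r).
    rewrite b0 /=; congr (_ :: map f _).
    have -> : pending (rcons s1 i) r = false.
      by rewrite /pending ptr mem_rcons inE eqxx andbF.
    have -> : [seq p <- rev s1b | pending (rcons s1 i) p] = [::].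
      rewrite -[RHS]b0; apply: eq_in_filter => p; rewrite mem_rev.
      move/ms1b => /andP[ltrp ltpi]; rewrite pend_rcons // pti => -[erp].
      by rewrite erp ltnn in ltrp.
    apply: eq_in_filter => p; rewrite mem_rev ms1a => ltpr.
    rewrite pend_rcons ?(ltn_trans ltpr) // pti => -[erp].
    by rewrite erp ltnn in ltpr.
  by rewrite st1 /= /closing pti ltri.
have st0 : stack s1 = [::].
  rewrite /stack; suff -> : [seq p <- rev s1 | pending s1 p] = [::] by [].
  apply/eqP; rewrite -[_ == _]negbK -has_filter; apply/hasPn => p.
  rewrite mem_rev ms1 => ltpi; apply/negP => /andP[ep].
  case ptp: (pt p) => [r|]; last by rewrite (pt_none ptp pti ltpi ei) in ep.
  rewrite ms1 -leqNgt leq_eqVlt => /orP[/eqP/val_inj eir|ltir].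
    by have [] := pt_sym ptp; rewrite -eir pti.
  by have [|j] := pt_nest (i := i) ptp; rewrite ?ltpi // pti.
have st0' : stack (rcons s1 i) = [::].
  rewrite -[RHS]st0 /stack rev_rcons /= {1}/pending ei /=.
  congr (map f _); apply: eq_in_filter => p; rewrite mem_rev ms1 => ltp.
  by rewrite pend_rcons // pti.
rewrite st0 st0' /= /closing pti ei /arc_weight.
by case: (f i).
Qed.

Lemma stack_weight_arcs :
  stack_weight [::] [seq (e p, f p) | p <- enum 'I_n] =
  \prod_p (if pt p is Some r
           then if (r < p)%N then arc_weight (f r) (f p) else 1
           else (f p == e p)%:R).
Proof.
have := @stack_weight_suffix [::] _ erefl; rewrite /stack /= => ->.
rewrite big_enum [X in _ * X]big_mkcond -big_split; apply: eq_bigr => p _ /=.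
rewrite /closing; case: (pt p) => [r|] /=; first by rewrite mulr1.
by case: (e p); rewrite ?mulr1 ?mul1r.
Qed.

End Arcs.
End Stack.

(** * The Hecke algebra *)

Lemma span_ind (K : fieldType) (V : vectType K) (X : seq V) (P : V -> Prop) :
  P 0 -> (forall u v, P u -> P v -> P (u + v)) ->
  (forall a v, P v -> P (a *: v)) -> (forall v, v \in X -> P v) ->
  forall v, v \in <<X>>%VS -> P v.
Proof.
move=> P0 PD PZ PX v /(@coord_span _ _ _ (in_tuple X))->.
by apply: big_ind => // i _; apply/PZ/PX/mem_nth.
Qed.

Lemma agenv_ind (K : fieldType) (A : falgType K) (X : seq A) (P : A -> Prop) :
  P 0 -> (forall u v, P u -> P v -> P (u + v)) ->
  (forall a v, P v -> P (a *: v)) -> P 1 ->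
  (forall u v, u \in X -> P v -> P (u * v)) ->
  forall v, v \in agenv <<X>> -> P v.
Proof.
move=> P0 PD PZ P1 PX _ /memv_sumP[w Pw ->].
apply: big_ind => // i _; move: (w i) (Pw i isT) => z.
elim: (nat_of_ord i) z => [z|d IHd].
  by rewrite expv0 => /vlineP[a ->]; exact: PZ.
rewrite expvSl [@prodv _ _]unlock; apply: span_ind => //.
move=> _ /allpairsP[[u v] [/= Xu dv ->]].
have Pv : P v by apply/IHd/vbasis_mem.
have {}Xu : u \in <<X>>%VS by apply: vbasis_mem.
have PM (z : A) : z \in <<X>>%VS -> P (z * v).
  apply: (@span_ind _ _ X (fun z => P (z * v))); first by rewrite mul0r.
  - by move=> y z' Py Pz; rewrite mulrDl; exact: PD.
  - by move=> a y Py; rewrite -scalerAl; exact: PZ.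
  - by move=> y Xy; exact: PX.
exact: PM.
Qed.

Section Hecke.
Variables (C : fieldType) (n : nat) (H : falgType (ratfun C)) (T : 'S_n -> H).
Hypothesis hT : is_hecke_basis T.
Let K := ratfun C.
Let q : K := qvar.

Lemma qvar_neq0 : q != 0.
Proof. by rewrite /q /qvar tofrac_eq0 polyX_eq0. Qed.

Lemma hecke_span h : h \in <<codom T>>%VS.
Proof. by rewrite (span_basis (hecke_basis hT)) memvf. Qed.

Lemma hecke_functional (F : 'S_n -> K) :
  exists phi : {linear H -> K^o}, forall x, phi (T x) = F x.
Proof.
pose phi0 (h : H) : K^o :=
  \sum_i coord (codom_tuple T) i h *: (F (enum_val i) : K^o).
have lin : linear phi0.
  move=> a u v; rewrite /phi0 scaler_sumr -big_split; apply: eq_bigr => i _ /=.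
  by rewrite linearP scalerDl scalerA.
exists (HB.pack_for {linear H -> K^o} phi0
          (GRing.isLinear.Build _ _ _ _ phi0 lin)) => x /=.
rewrite /phi0 (bigD1 (enum_rank x)) //= big1 => [|i nix].
  rewrite -[T x](_ : (codom_tuple T)`_(enum_rank x) = _); last first.
    by rewrite nth_codom enum_rankK.
  rewrite coord_free ?(basis_free (hecke_basis hT)) // eqxx addr0 enum_rankK.
  exact: mul1r.
rewrite -[T x](_ : (codom_tuple T)`_(enum_rank x) = _); last first.
  by rewrite nth_codom enum_rankK.
rewrite coord_free ?(basis_free (hecke_basis hT)) // eq_sym (negbTE nix).
exact: scale0r.
Qed.

Lemma hecke1 : T 1%g = 1.
Proof.
suff T1 h : T 1%g * h = h by rewrite -[LHS]mulr1 T1.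
move: h (hecke_span h); apply: span_ind.
- by rewrite mulr0.
- by move=> u v eu ev; rewrite mulrDr eu ev.
- by move=> a v ev; rewrite -scalerAr ev.
- by move=> _ /codomP[x ->]; rewrite (hecke_mul hT) ?mul1g ?len1.
Qed.

Lemma hecke_simple_sq s : s \in simple n ->
  T s * T s = 1 + (q^-1 - q) *: T s.
Proof.
move=> Ss; rewrite (hecke_mul_simple hT) ?(simple_invol Ss) ?hecke1 //.
by rewrite len_simple ?len1.
Qed.

Lemma hecke_simpleM_up s x : s \in simple n ->
  len (s * x)%g = (len x).+1 -> T s * T x = T (s * x)%g.
Proof. by move=> Ss e; rewrite (hecke_mul hT) // e (len_simple Ss). Qed.

Lemma hecke_simpleM_down s x : s \in simple n ->
  len x = (len (s * x)%g).+1 ->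
  T s * T x = T (s * x)%g + (q^-1 - q) *: T x.
Proof.
move=> Ss e; have ex : x = (s * (s * x))%g by rewrite mulgA simple_invol // mul1g.
have up : T s * T (s * x)%g = T x.
  by rewrite hecke_simpleM_up // -ex.
by rewrite -{1}up mulrA hecke_simple_sq // mulrDl mul1r -scalerAl up.
Qed.

Lemma hecke_simpleV s : s \in simple n -> (T s)^-1 = T s - (q^-1 - q)%:A.
Proof.
move=> Ss; have eR : T s * (T s - (q^-1 - q)%:A) = 1.
  by rewrite mulrBr hecke_simple_sq // mulr_algr addrK.
have eL : (T s - (q^-1 - q)%:A) * T s = 1.
  by rewrite mulrBl hecke_simple_sq // mulr_algl addrK.
have Us : T s \is a GRing.unit by apply/unitrP; exists (T s - (q^-1 - q)%:A).
by apply: (mulrI Us); rewrite mulrV // eR.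
Qed.

Definition lower (m : nat) : {vspace H} :=
  <<[seq T x | x in [pred x : 'S_n | (len x < m)%N]]>>%VS.

Lemma mem_lower m x : (len x < m)%N -> T x \in lower m.
Proof. by move=> ltx; apply/memv_span/image_f; rewrite inE. Qed.

Lemma lower_ind m (P : H -> Prop) :
  P 0 -> (forall u v, P u -> P v -> P (u + v)) ->
  (forall a v, P v -> P (a *: v)) ->
  (forall x, (len x < m)%N -> P (T x)) -> forall h, h \in lower m -> P h.
Proof.
move=> P0 PD PZ PT; apply: span_ind => // _ /imageP[x ltx ->].
by apply: PT; rewrite inE in ltx.
Qed.

Lemma lowerS m m' h : (m <= m')%N -> h \in lower m -> h \in lower m'.
Proof.
move=> lem; move: h; apply: lower_ind.
- exact: mem0v.
- by move=> u v; exact: memvD.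
- by move=> a v; exact: memvZ.
- by move=> x ltx; apply/mem_lower/leq_trans/lem.
Qed.

Lemma lowerM m s h : s \in simple n -> h \in lower m -> T s * h \in lower m.+1.
Proof.
move=> Ss; move: h; apply: lower_ind.
- by rewrite mulr0 mem0v.
- by move=> u v; rewrite mulrDr; exact: memvD.
- by move=> a v; rewrite -scalerAr; exact: memvZ.
move=> x ltx; case: (len_simpleM x Ss) => e.
  by rewrite hecke_simpleM_up // mem_lower // e.
rewrite hecke_simpleM_down //; apply: memvD.
  by rewrite mem_lower // -e leqW // ltnW.
by apply/memvZ/mem_lower/leqW.
Qed.

Section Bar.
Variables (bar : {rmorphism K -> K}) (barH : {rmorphism H -> H}).
Hypotheses (hbar : is_bar bar) (hbarH : is_hecke_bar bar T barH).

Lemma barH_simple s : s \in simple n -> barH (T s) = T s - (q^-1 - q)%:A.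
Proof.
by move=> Ss; rewrite (hecke_bar_basis hbarH) (simpleV Ss) hecke_simpleV.
Qed.

(** Induction on the length, starting from the fact that the inverse of T_s differs
    from T_s by a scalar. *)
Lemma barH_lower x : barH (T x) - T x \in lower (len x).
Proof.
move: {2}(len x) (erefl (len x)) => m; elim: m x => [|m IHm] x lx.
  by rewrite (len_eq0 lx) hecke1 rmorph1 subrr mem0v.
have [x1|/perm_descent[a [b [eb ltx]]]] := eqVneq x 1%g.
  by rewrite x1 len1 in lx.
have Ss := tperm_simple eb; set s := tperm a b in Ss *.
have exs : x = (s * (s * x))%g by rewrite mulgA simple_invol // mul1g.
have lx' : len x = (len (s * x)%g).+1.
  by rewrite {1}exs len_tpermM // !permM tpermL tpermR.
have lsx : len (s * x)%g = m by move: lx' lx; lia.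
move: (IHm _ lsx); set l := _ - _ => ll.
have -> : T x = T s * T (s * x)%g by rewrite hecke_simpleM_up // -?exs.
have el : barH (T (s * x)%g) = l + T (s * x)%g by rewrite subrK.
rewrite rmorphM barH_simple //= el.
have -> : (T s - (q^-1 - q)%:A) * (l + T (s * x)%g) - T s * T (s * x)%g =
    T s * l - (q^-1 - q) *: (l + T (s * x)%g).
  by rewrite mulrBl mulr_algl mulrDr addrAC addrK.
rewrite lx -{}lsx in ll *; apply: memvB; first exact: lowerM.
by apply/memvZ/memvD; [apply: lowerS ll | apply: mem_lower].
Qed.

End Bar.
End Hecke.

(** * The spherical module *)

Local Notation "x %:F" := (FracField.tofrac x) : ring_scope.

Lemma quadratic_weight (F : fieldType) (q u b : F) : q != 0 -> u != 0 ->
  u^-1 * b + (q^-1 - q) * ((q * u)^-1 * b) = q^-1 * ((q * u)^-1 * b).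
Proof. by move=> q0 u0; field; rewrite ?q0 ?u0. Qed.

Lemma shift_power (F : fieldType) (q a : F) d i : q != 0 ->
  q ^+ (d + i.+1) * (q^-1 * (a * q^-1 ^+ i)) = a * q ^+ d.
Proof.
move=> q0; rewrite exprD exprS exprVn; field.
by rewrite q0 expf_neq0.
Qed.

Section Module.
Variables (C : fieldType) (n k : nat).
Let K := ratfun C.
Let q : K := qvar.
Variables (H : falgType K) (T : 'S_n -> H).
Hypothesis hT : is_hecke_basis T.
Variables (act : H -> K -> K) (M : lmodType H) (t : H -> K -> M).
Hypotheses (hact : is_triv_action k T act)
  (ht : is_tensor (mem (heckeJ k T)) act t).

Lemma scalar_heckeJ (c : K) : c%:A \in heckeJ k T.
Proof. by apply/(subvP (sub1_agenv _))/memvZ/memv_line. Qed.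

(** The tensor product is generated by the pure tensors with second factor 1, on
    which the bar involution is prescribed. *)
Lemma tensorE c h : t h c = t (c *: h) 1.
Proof.
rewrite -(mulr_algr c h) (balanced_act (tensor_balanced ht)) ?scalar_heckeJ //.
by rewrite (triv_scalar hact) mulr1.
Qed.

Lemma tensorD h h' : t (h + h') 1 = t h 1 + t h' 1.
Proof. exact: (balanced_addl (tensor_balanced ht)). Qed.

Lemma tensor0 : t 0 1 = 0.
Proof. by apply: (addIr (t 0 1)); rewrite -tensorD !add0r. Qed.

Lemma tensor_sum (I : Type) (r : seq I) (P : pred I) (F : I -> H) :
  t (\sum_(i <- r | P i) F i) 1 = \sum_(i <- r | P i) t (F i) 1.
Proof. by apply: (big_morph (t^~ 1)); [exact: tensorD | exact: tensor0]. Qed.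

Lemma tensor_algZ c h : (c%:A : H) *: t h 1 = t (c *: h) 1.
Proof. by rewrite (tensor_scale ht) mulr_algl. Qed.

Lemma tensor_simpleJ h s : s \in simpleJ n k -> t (h * T s) 1 = t (q^-1 *: h) 1.
Proof.
move=> Js; have bs : T s \in heckeJ k T.
  by apply: (subvP (sub_agenv _)); apply/memv_span/image_f.
rewrite (balanced_act (tensor_balanced ht)) // (triv_simple hact) //.
by rewrite mulr1 tensorE.
Qed.

(** The elements b of the parabolic subalgebra such that
    phi (h * b) * c = phi h * act b c for all h and c form a subalgebra containing
    the T_s, so this pairing is balanced and descends to the tensor product. *)
Lemma tensor_functional (phi : {linear H -> K^o}) :
  (forall h s, s \in simpleJ n k -> phi (h * T s) = q^-1 * phi h) ->
  exists g : {additive M -> K}, forall h, g (t h 1) = phi h.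
Proof.
move=> phiJ; pose f (h : H) (c : K) : K := phi h * c.
have [g Dg] : exists g : {additive M -> K}, forall a x, g (t a x) = f a x.
  apply: (tensor_lift ht); split=> [a a' x|a x x'|a b x].
  - by rewrite /f linearD mulrDl.
  - by rewrite /f mulrDr.
  pose P b := b \in heckeJ k T /\ forall h c, f (h * b) c = f h (act b c).
  suff PJ : forall b, b \in heckeJ k T -> P b by move/PJ=> [].
  apply: agenv_ind.
  - split=> [|h c]; first exact: mem0v.
    have -> : act 0 c = 0 by rewrite -(scale0r (1 : H)) (triv_scalar hact) mul0r.
    by rewrite /f mulr0 linear0 mul0r mulr0.
  - move=> u v [Ju eu] [Jv ev]; split=> [|h c]; first exact: memvD.
    rewrite (triv_addl hact) // /f mulrDr linearD mulrDl mulrDr.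
    by rewrite -!/(f _ _) eu ev.
  - move=> c v [Jv ev]; split=> [|h d]; first exact: memvZ.
    rewrite -mulr_algl (triv_mul hact) ?scalar_heckeJ // (triv_scalar hact).
    rewrite mulr_algl -scalerAr /f linearZ /=.
    by rewrite -[c *: _]/(c * _) -mulrA -/(f _ _) ev /f mulrCA.
  - split=> [|h c]; first by rewrite -(scale1r 1) scalar_heckeJ.
    by rewrite mulr1 -[X in act X](scale1r 1) (triv_scalar hact) mul1r.
  move=> _ v /imageP[s Js ->] [Jv ev].
  have bs : T s \in heckeJ k T.
    by apply: (subvP (sub_agenv _)); apply/memv_span/image_f.
  split=> [|h c]; first exact: memvM.
  rewrite mulrA ev (triv_mul hact) // (triv_simple hact) // /f phiJ //.
  by rewrite mulrCA mulrA.
by exists g => h; rewrite Dg /f mulr1.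
Qed.

(** Whether x s is longer or shorter than x, the quadratic relation yields the same
    factor q^-1.  Normalizing by the length of x rather than by its distance to
    the minimal element of the coset avoids any factorization of x along W_J. *)
Lemma coset_functional (A : {set 'I_n}) :
  exists (g : {additive M -> K}) (phi : {linear H -> K^o}),
    (forall h, g (t h 1) = phi h) /\
    (forall x, phi (T x) = q ^- len x * (mset k x == A)%:R).
Proof.
have [phi Dphi] := hecke_functional hT
  (fun x => q ^- len x * (mset k x == A)%:R).
suff [g Dg] : exists g : {additive M -> K}, forall h, g (t h 1) = phi h.
  by exists g, phi.
apply: tensor_functional => h s Js.
have Ss : s \in simple n by apply: (subsetP (sub_simpleJ n k)).
move: h (hecke_span hT h).
apply: (@span_ind _ _ _ (fun h => phi (h * T s) = q^-1 * phi h)).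
- by rewrite mul0r linear0 mulr0.
- by move=> u v eu ev; rewrite mulrDl !linearD /= eu ev mulrDr.
- move=> a v ev; rewrite -scalerAl !linearZ /= ev.
  by rewrite -![a *: _]/(a * _) mulrCA.
have q0 := qvar_neq0 C.
have mxs x : mset k (x * s)%g = mset k x by apply/mset_mulWJ/mem_gen.
move=> _ /codomP[x ->]; case: (len_Msimple x Ss) => e.
  rewrite (hecke_mul hT) ?e ?(len_simple Ss) ?addn1 // !Dphi mxs e.
  by rewrite exprSr invfM mulrA [q^-1 * _]mulrC.
rewrite (hecke_mul_simple hT) // linearD linearZ /= !Dphi mxs e.
set u := q ^+ _; have u0 : u != 0 by rewrite expf_neq0.
set b := (_ == _)%:R; rewrite exprS -/u.
rewrite -[_ *: _]/((q^-1 - q) * _); exact: quadratic_weight.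
Qed.

(** The coset of a minimal representative y has no element shorter than y. *)
Lemma coset_functional_lower (y : 'S_n) (phi : {linear H -> K^o}) h :
  y \in minrep n k ->
  (forall x, phi (T x) = q ^- len x * (mset k x == mset k y)%:R) ->
  h \in lower T (len y) -> phi h = 0.
Proof.
move=> /minrepP gy Dphi; move: h; apply: lower_ind.
- exact: linear0.
- by move=> u v eu ev; rewrite linearD /= eu ev addr0.
- by move=> a v ev; rewrite linearZ /= ev scaler0.
move=> x ltx; rewrite Dphi; case: eqP => [/(grass_min gy)|]; last by rewrite mulr0.
by rewrite leqNgt ltx.
Qed.

Lemma minrep_inj x y : x \in minrep n k -> y \in minrep n k ->
  (mset k x == mset k y) = (x == y).
Proof.
move=> /minrepP gx /minrepP gy; apply/eqP/eqP => [|->//].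
exact: grass_inj.
Qed.

Lemma stdM_inj x y : x \in minrep n k -> y \in minrep n k ->
  stdM T t x = stdM T t y -> x = y.
Proof.
move=> mx my; have [g [phi [Dg Dphi]]] := coset_functional (mset k x).
move/(congr1 g); rewrite /stdM !Dg !Dphi eqxx (minrep_inj my mx) mulr1.
have [->//|_] := eqVneq y x; rewrite mulr0 => /eqP.
by rewrite invr_eq0 expf_eq0 (negbTE (qvar_neq0 C)) andbF.
Qed.

Lemma in_qinvZ0 : in_qinvZ (0 : K).
Proof. by exists 0; rewrite rmorph0 horner0 mulr0. Qed.

Lemma in_qinvZD (a b : K) : in_qinvZ a -> in_qinvZ b -> in_qinvZ (a + b).
Proof.
by case=> p -> [r ->]; exists (p + r); rewrite rmorphD hornerD mulrDr.
Qed.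

Lemma in_qinvZN (a : K) : in_qinvZ a -> in_qinvZ (- a).
Proof. by case=> p ->; exists (- p); rewrite rmorphN hornerN mulrN. Qed.

Lemma in_qinvZ_sign d : (0 < d)%N -> in_qinvZ ((- q^-1) ^+ d).
Proof.
case: d => // d _; exists ((-1) ^+ d.+1 *: 'X^d); rewrite map_polyZ map_polyXn.
rewrite hornerZ hornerXn rmorphXn rmorphN1 exprNn [q^-1 ^+ _]exprS.
by rewrite mulrCA.
Qed.

Variables (bar : {rmorphism K -> K}) (barH : {rmorphism H -> H}).
Hypotheses (hbar : is_bar bar) (hbarH : is_hecke_bar bar T barH).
Variable barM : {additive M -> M}.
Hypothesis hbarM : forall h, barM (t h 1) = t (barH h) 1.

(** Such an element c has the form q^-1 P(q^-1), and is fixed by the bar involution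
    if this equals q P(q).  Multiplied by q^N, where P has degree less than N, the
    first is a polynomial of degree less than N in q, the second a multiple of
    q^(N+1). *)
Lemma bar_qinvZ (c : K) : in_qinvZ c -> bar c = c -> c = 0.
Proof.
case=> p ec; rewrite ec; set N := size p.
have hornerE (x : K) :
    (map_poly intr p).[x] = \sum_(i < N) (p`_i)%:~R * x ^+ i :> K.
  rewrite (@horner_coef_wide _ N) ?size_poly //.
  by apply: eq_bigr => i _; rewrite coef_map.
pose r : {poly C} := \sum_(i < N) (p`_i)%:~R * 'X^i.
pose r' : {poly C} := \sum_(i < N) (p`_i)%:~R * 'X^(N - i.+1).
have -> : bar (q^-1 * (map_poly intr p).[q^-1]) = q * r%:F.
  rewrite rmorphM fmorphV /= (bar_q hbar) invrK hornerE !rmorph_sum.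
  congr (_ * _); apply: eq_bigr => i _.
  rewrite !rmorphM !rmorph_int !rmorphXn /= fmorphV /= (bar_q hbar).
  by rewrite invrK.
have q0 := qvar_neq0 C.
have er' : q ^+ N * (q^-1 * (map_poly intr p).[q^-1]) = r'%:F.
  rewrite hornerE !mulr_sumr rmorph_sum; apply: eq_bigr => i _.
  rewrite rmorphM rmorph_int rmorphXn /= -/q.
  by rewrite -{1}(subnK (ltn_ord i)) shift_power.
move=> eqr; rewrite -eqr; move/(congr1 (fun z : K => q ^+ N * z)): eqr.
rewrite er'.
have -> : q ^+ N * (q * r%:F) = ('X^(N.+1) * r)%:F.
  by rewrite rmorphM rmorphXn exprSr mulrA.
move/eqP; rewrite tofrac_eq => /eqP er.
have [-> | r0] := eqVneq r 0; first by rewrite rmorph0 mulr0.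
have szr' : (size r' <= N)%N.
  apply: (leq_trans (size_sum _ _ _)); apply/bigmax_leqP => i _.
  rewrite -(rmorph_int polyC) mul_polyC; apply: leq_trans (size_scale_leq _ _) _.
  by rewrite size_polyXn; have := ltn_ord i; lia.
move: szr'; rewrite -er mulrC size_mulXn // => szr.
by move: (size r) szr => sr; lia.
Qed.

(** The coset functional of a longest y whose coefficient is not zero only sees the
    coefficient of M_y, both in d and, by unitriangularity, in its image; this
    coefficient is then bar-invariant. *)
Lemma bar_lin_indep (c : 'S_n -> K) :
  (forall y, y \in minrep n k -> in_qinvZ (c y)) ->
  let d := \sum_(y in minrep n k) ((c y)%:A : H) *: stdM T t y in
  barM d = d -> d = 0.
Proof.
move=> qc d; have -> : d = t (\sum_(y in minrep n k) c y *: T y) 1.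
  by rewrite tensor_sum; apply: eq_bigr => y _; rewrite -tensor_algZ.
rewrite hbarM rmorph_sum /= => ed.
suff c0 y : y \in minrep n k -> c y = 0.
  rewrite big1 ?tensor0 // => y my; by rewrite c0 // scale0r.
move=> my; apply/eqP/negPn/negP => cy.
pose P x := (x \in minrep n k) && (c x != 0).
have Py : P y by rewrite /P my.
case: (@arg_maxnP _ y P (@len n) Py) => x /andP[mx cx] maxx.
have [g [phi [Dg Dphi]]] := coset_functional (mset k x).
move/(congr1 g): ed; rewrite !Dg !linear_sum /=.
have ql0 : q ^- len x != 0.
  by rewrite invr_eq0 expf_eq0 (negbTE (qvar_neq0 C)) andbF.
rewrite (bigD1 x) //= [in RHS](bigD1 x) //= !big1; first last.
- move=> z /andP[mz nzx]; rewrite (hecke_bar_antilinear hbarH) linearZ /=.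
  have [->|cz] := eqVneq (c z) 0; first by rewrite rmorph0 scale0r.
  have lez : (len z <= len x)%N by apply: maxx; rewrite /P mz.
  rewrite -[barH _](subrK (T z)) linearD /= Dphi minrep_inj // (negbTE nzx).
  rewrite (coset_functional_lower mx Dphi) ?mulr0 ?addr0 ?scaler0 //.
  exact: lowerS lez (barH_lower hT hbarH z).
- by move=> z /andP[mz nzx]; rewrite linearZ /= Dphi minrep_inj // (negbTE nzx)
     mulr0 scaler0.
rewrite !addr0 (hecke_bar_antilinear hbarH) !linearZ /=.
rewrite -[barH _](subrK (T x)) linearD /=.
rewrite (coset_functional_lower mx Dphi (barH_lower hT hbarH x)) add0r Dphi.
rewrite eqxx mulr1 => /(mulIf ql0) /(bar_qinvZ (qc x mx)) cx0.
by rewrite cx0 eqxx in cx.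
Qed.

End Module.

(** * Bar-invariant vectors from sign words *)

Definition swap_state n (a b : 'I_n) (e : state n) : state n :=
  [ffun i => e (rev_ord (tperm a b (rev_ord i)))].

Lemma swap_stateE n (a b : 'I_n) (e : state n) p :
  swap_state a b e (rev_ord p) = e (rev_ord (tperm a b p)).
Proof. by rewrite ffunE rev_ordK. Qed.

Lemma swap_stateK n (a b : 'I_n) : involutive (swap_state a b).
Proof.
by move=> e; apply/ffunP=> i; rewrite !ffunE !rev_ordK tpermK rev_ordK.
Qed.

Lemma card_swap_state n (a b : 'I_n) (e : state n) :
  #|[set i | swap_state a b e i]| = #|[set i | e i]|.
Proof.
have inj : injective (fun i : 'I_n => rev_ord (tperm a b (rev_ord i))).
  by move=> i j /rev_ord_inj/perm_inj/rev_ord_inj.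
rewrite -[RHS](card_preimset _ inj); apply: eq_card => i.
by rewrite !inE ffunE.
Qed.

(** The places a and b belong to different blocks, so exchanging them does not
    affect the order inside the blocks. *)
Lemma seq_perm_swap n k (a b : 'I_n) (e : state n) : b = a.+1 :> nat ->
  #|[set i | e i]| = k -> e (rev_ord a) != e (rev_ord b) ->
  seq_perm k (swap_state a b e) = (tperm a b * seq_perm k e)%g.
Proof.
move=> eb ek ne; have [gw mw] := seq_permP ek.
have [gs ms] := seq_permP (etrans (card_swap_state a b e) ek).
have mE : mset k (tperm a b * seq_perm k e)%g = minus_set (swap_state a b e).
  apply/setP=> p; rewrite inE permM; move/setP/(_ (tperm a b p)): mw.
  by rewrite !inE swap_stateE.
apply: grass_inj gs _ _; last by rewrite ms mE.
move=> i j ltij; rewrite mE !inE !swap_stateE !permM => eij.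
have [[ia jb]|nab] := eqVneq (i, j) (a, b).
  by move: eij ne; rewrite ia jb tpermL tpermR => ->; rewrite eqxx.
by apply: gw; [exact: adjacent_tperm_lt | rewrite mw !inE].
Qed.

Lemma enum_ord_adjacent n (a b : 'I_n) : b = a.+1 :> nat ->
  exists s1 s2, enum 'I_n = s1 ++ a :: b :: s2 /\
    {in s1 ++ s2, forall p, tperm a b p = p}.
Proof.
move=> eb; have [s1 [s2 es]] : exists s1 s2, enum 'I_n = s1 ++ a :: s2.
  have : a \in enum 'I_n by rewrite mem_enum.
  by case/splitPr => s1 s2; exists s1, s2.
have nb1 : b \notin rcons s1 a.
  by rewrite mem_rcons inE (enum_ord_splitE (esym es)) -val_eqE /= eb; lia.
case: s2 es => [|c s2] es.
  by move: nb1; rewrite -cats1 -es mem_enum.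
have ec : c = b.
  have := enum_ord_splitE (etrans (cat_rcons _ _ _) (esym es)) => mc.
  apply: ord_inj; have := mc a; have := mc b.
  by rewrite (negbTE nb1) mem_rcons mem_head eb; lia.
exists s1, s2; split=> [|p]; first by rewrite es ec.
have := enum_uniq 'I_n; rewrite es ec uniq_catC /= => /and3P[].
rewrite inE negb_or => /andP[_ na] nb _ ps.
by rewrite tpermD //; apply: contraTneq ps => <-; rewrite mem_cat orbC -mem_cat.
Qed.

Section Canonical.
Variables (C : fieldType) (n : nat).
Let K := ratfun C.
Let q : K := qvar.

(** The vector of the word of parentheses e. *)
Definition canon (e : state n) : tensV C n :=
  [ffun f : state n => stack_weight q [::]
    [seq (e (rev_ord p), f (rev_ord p)) | p <- enum 'I_n] : (ratfun C)^o].

(** The Temperley-Lieb generator at the places a and b. *)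
Definition capcup (a b : 'I_n) (X : tensV C n) : tensV C n :=
  [ffun f : state n =>
    if f (rev_ord a) == f (rev_ord b) then 0
    else X (swap_state a b f) - cap_coef q (f (rev_ord a)) *: X f].

Lemma canon_capcup (a b : 'I_n) (e : state n) : b = a.+1 :> nat ->
  e (rev_ord a) = false -> e (rev_ord b) = true ->
  canon e = capcup a b (canon (swap_state a b e)).
Proof.
move=> eb ea eB; apply/ffunP=> f; rewrite !ffunE.
have [s1 [s2 [es fix12]]] := enum_ord_adjacent eb.
rewrite es !map_cat /= !swap_stateE tpermL tpermR ea eB.
have fix1 (g : state n) p : p \in s1 ->
    swap_state a b g (rev_ord p) = g (rev_ord p).
  by move=> ps; rewrite swap_stateE fix12 // mem_cat ps.
have fix2 (g : state n) p : p \in s2 ->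
    swap_state a b g (rev_ord p) = g (rev_ord p).
  by move=> ps; rewrite swap_stateE fix12 // mem_cat ps orbT.
rewrite stack_weight_swap ?qvar_neq0 //; case: ifP => // _.
congr (stack_weight q [::] (_ ++ _ :: _ :: _) -
       _ * stack_weight q [::] (_ ++ _ :: _ :: _)).
- by apply/eq_in_map => p ps; rewrite !fix1.
- by apply/eq_in_map => p ps; rewrite !fix2.
- by apply/eq_in_map => p ps; rewrite !fix1.
- by apply/eq_in_map => p ps; rewrite !fix2.
Qed.

Lemma canon_sorted k (e : state n) : (forall p, e (rev_ord p) = (p < k)%N) ->
  canon e = stdV C e.
Proof.
move=> ee; apply/ffunP=> f; rewrite !ffunE stack_weight_sorted; last first.
  rewrite pairwise_map; apply: (@sub_pairwise _ (relpre val ltn)).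
    by move=> i j /= ltij; rewrite !ee; apply/implyP; exact: ltn_trans.
  rewrite -pairwise_map val_enum_ord -sorted_pairwise ?iota_ltn_sorted //.
  exact: ltn_trans.
congr (nat_of_bool _)%:R; rewrite all_map; apply/allP/eqP => [eq_ef|-> p _];
  last by rewrite /= eqxx.
apply/ffunP=> i; apply/esym/eqP; rewrite -(rev_ordK i).
by apply: eq_ef; rewrite mem_enum.
Qed.

End Canonical.

Section BarInvariance.
Variables (C : fieldType) (n k : nat).
Let K := ratfun C.
Let q : K := qvar.
Variables (H : falgType K) (T : 'S_n -> H).
Hypothesis hT : is_hecke_basis T.
Variables (act : H -> K -> K) (M : lmodType H) (t : H -> K -> M).
Hypotheses (hact : is_triv_action k T act)
  (ht : is_tensor (mem (heckeJ k T)) act t).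

Lemma Seq_invE (X : tensV C n) : Seq_inv k T t X =
  t (\sum_(e : state n | #|[set i | e i]| == k) X e *: T (seq_perm k e)) 1.
Proof.
rewrite (tensor_sum ht); apply: eq_bigr => e _.
by rewrite (tensor_algZ ht).
Qed.

Lemma Seq_inv_stdV (e : state n) : #|[set i | e i]| = k ->
  Seq_inv k T t (stdV C e) = stdM T t (seq_perm k e).
Proof.
move=> ek; rewrite Seq_invE (bigD1 e) ?ek //= big1 => [|e' /andP[_ ne]].
  by rewrite addr0 ffunE eqxx scale1r.
by rewrite ffunE (negbTE ne) scale0r.
Qed.

Lemma Seq_inv_sum (I : Type) (r : seq I) (P : pred I) (c : I -> K)
    (X : I -> tensV C n) :
  \sum_(i <- r | P i) ((c i)%:A : H) *: Seq_inv k T t (X i) =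
  Seq_inv k T t (\sum_(i <- r | P i) c i *: X i).
Proof.
rewrite Seq_invE (eq_bigr (fun i => t (c i *:
    (\sum_(e : state n | #|[set i | e i]| == k) X i e *: T (seq_perm k e))) 1));
  last by move=> i _; rewrite Seq_invE (tensor_algZ ht).
rewrite -(tensor_sum ht); congr (t _ 1).
rewrite (eq_bigr (fun i => \sum_(e : state n | #|[set i | e i]| == k)
    (c i * X i e) *: T (seq_perm k e))); last first.
  by move=> i _; rewrite scaler_sumr; apply: eq_bigr => e _; rewrite scalerA.
rewrite exchange_big; apply: eq_bigr => e _ /=.
rewrite -scaler_suml; congr (_ *: _).
elim/big_rec2: _ => [|i y x _ ->]; first by rewrite ffunE.
by rewrite !ffunE.
Qed.

(** If the signs at a and b differ, this is left multiplication by a simple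
    reflection that changes the coset.  If they agree, s w = w s' for a simple
    reflection s' of W_J, and T_s' acts on the trivial module by q^-1. *)
Lemma cap_action (a b : 'I_n) (e : state n) : b = a.+1 :> nat ->
  #|[set i | e i]| = k ->
  t ((T (tperm a b) - q^-1%:A) * T (seq_perm k e)) 1 =
  if e (rev_ord a) == e (rev_ord b) then 0
  else t (T (seq_perm k (swap_state a b e))) 1
       - t (cap_coef q (e (rev_ord a)) *: T (seq_perm k e)) 1.
Proof.
move=> eb ek; have [gw /setP mw] := seq_permP ek.
have Ss := tperm_simple eb; set s := tperm a b in Ss *.
have tB h h' : t (h - h') 1 = t h 1 - t h' 1.
  by apply: (addIr (t h' 1)); rewrite subrK -(tensorD ht) subrK.
rewrite mulrBl mulr_algl tB.
have ma := mw a; have mb := mw b; move: ma mb; rewrite !inE.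
set w := seq_perm k e in gw mw *; have [eab|neab] := eqVneq => ma mb.
  have ltw : (w a < w b)%N by apply: gw; rewrite ?eb // !inE ma mb.
  (* w increases on the block of a and b, so no value of this block lies
     between w a and w b *)
  have ewb : w b = (w a).+1 :> nat.
    apply/eqP; rewrite eqn_leq ltw andbT leqNgt; apply/negP => ltv.
    pose v : 'I_n := Ordinal (ltn_trans ltv (ltn_ord (w b))).
    have wp : w (w^-1%g v) = v by rewrite permKV.
    have va : v = (w a).+1 :> nat by [].
    move: (w^-1%g v) wp => p wp.
    have cp : (p \in mset k w) = (a \in mset k w) by rewrite !inE wp va; lia.
    have cb : (b \in mset k w) = (a \in mset k w) by rewrite !inE ma mb.
    have [ltpa|ltap|/val_inj epa] := ltngtP p a.
    - by have := gw _ _ ltpa cp; rewrite wp va; lia.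
    - have [ltpb|ltbp|/val_inj epb] := ltngtP p b; first by lia.
        by have := gw _ _ ltbp (etrans cb (esym cp)); rewrite wp va; lia.
      by have := ltv; rewrite -epb wp va ltnn.
    by move: va; rewrite -wp epa; lia.
  have wk : (w b != k :> nat) by move: ma mb; rewrite ewb; lia.
  have -> : T s * T w = T w * T (tperm (w a) (w b)).
    rewrite hecke_simpleM_up ?len_tpermM // (hecke_mul hT).
      by rewrite -tpermJ -conjgC.
    rewrite len_tperm // addn1 -(len_tpermM eb ltw).
    by rewrite -tpermJ -conjgC.
  by rewrite (tensor_simpleJ hact ht) ?tperm_simpleJ // subrr.
rewrite (seq_perm_swap eb ek neab) -/s -/w /cap_coef.
case ea: (e (rev_ord a)) ma neab => ma.
  case eB: (e (rev_ord b)) mb => // mb _.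
  by rewrite hecke_simpleM_up // len_tpermM //; lia.
case eB: (e (rev_ord b)) mb => // mb _.
have lt' : ((s * w)%g a < (s * w)%g b)%N.
  rewrite !permM /s tpermL tpermR. by apply: leq_trans mb _; rewrite leqNgt ma.
rewrite hecke_simpleM_down //; last first.
  by rewrite -(len_tpermM eb lt') mulgA tperm2 mul1g.
by rewrite (tensorD ht) scalerBl tB addrA addrAC addrK.
Qed.

Lemma cap_Seq_inv (a b : 'I_n) (X : tensV C n) : b = a.+1 :> nat ->
  (T (tperm a b) - q^-1%:A) *: Seq_inv k T t X =
  Seq_inv k T t (capcup a b X).
Proof.
move=> eb; rewrite !Seq_invE (tensor_scale ht) mulr_sumr !(tensor_sum ht).
pose S (e : state n) := T (seq_perm k e).
transitivity (\sum_(e : state n | (#|[set i | e i]| == k) &&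
      (e (rev_ord a) != e (rev_ord b)))
    (t (X e *: S (swap_state a b e)) 1
      - t ((X e * cap_coef q (e (rev_ord a))) *: S e) 1)).
  rewrite [RHS]big_mkcondr; apply: eq_bigr => e /eqP ek.
  rewrite -scalerAr -(tensor_algZ ht) cap_action //.
  case: eqP => _ /=; first by rewrite scaler0.
  by rewrite scalerBr !(tensor_algZ ht) scalerA.
rewrite sumrB [X in X - _](reindex_inj (inv_inj (@swap_stateK n a b))) /=.
rewrite (eq_bigl (fun e : state n => (#|[set i | e i]| == k) &&
      (e (rev_ord a) != e (rev_ord b)))); last first.
  by move=> e; rewrite card_swap_state !swap_stateE tpermL tpermR;
    rewrite [e (rev_ord b) == _]eq_sym.
rewrite -sumrB big_mkcondr; apply: eq_bigr => e _.
rewrite swap_stateK ffunE; case: eqP => _ /=; first by rewrite scale0r (tensor0 ht).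
rewrite scalerBl -/(S e).
apply: (addIr (t ((X e * cap_coef q (e (rev_ord a))) *: S e) 1)).
by rewrite subrK -(tensorD ht) [X e * _]mulrC subrK.
Qed.

Variables (bar : {rmorphism K -> K}) (barH : {rmorphism H -> H}).
Hypotheses (hbar : is_bar bar) (hbarH : is_hecke_bar bar T barH).
Variable barM : {additive M -> M}.
Hypothesis hbarM : forall h, barM (t h 1) = t (barH h) 1.

Lemma barH_cap s : s \in simple n -> barH (T s - q^-1%:A) = T s - q^-1%:A.
Proof.
move=> Ss; rewrite rmorphB /= (barH_simple hT hbarH Ss).
rewrite (hecke_bar_antilinear hbarH) rmorph1 fmorphV /= (bar_q hbar) invrK.
by rewrite scalerBl opprB addrA addrAC addrK.
Qed.

(** Induction on the length of the permutation of e.  A descent of it is a place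
    where e has +-, and exchanging the two signs shortens the permutation. *)
Lemma bar_canon (e : state n) : #|[set i | e i]| = k ->
  barM (Seq_inv k T t (canon C e)) = Seq_inv k T t (canon C e).
Proof.
move: {2}(len _) (erefl (len (seq_perm k e))) => m.
elim: m e => [|m IHm] e lw ek; have [gw mw] := seq_permP ek.
  have w1 := len_eq0 lw.
  have -> : canon C e = stdV C e.
    apply: (@canon_sorted C n k) => p; have /setP/(_ p) := mw.
    by rewrite w1 !inE perm1.
  by rewrite Seq_inv_stdV // w1 /stdM hbarM (hecke1 hT) rmorph1.
have [w1|/perm_descent[a [b [eb ltw]]]] := eqVneq (seq_perm k e) 1%g.
  by rewrite w1 len1 in lw.
have ltab : (a < b)%N by rewrite eb.
have [ea eB] : e (rev_ord a) = false /\ e (rev_ord b) = true.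
  have := gw a b ltab; move/setP: mw => mw; have := mw a; have := mw b.
  rewrite !inE => <- <-; move: ltw; move: (seq_perm k e) => w.
  case: (ltnP (w a) k) => wa; case: (ltnP (w b) k) => wb //= ltw.
  - by move=> /(_ erefl); rewrite ltnNge ltnW.
  - by have := leq_trans wa (leq_trans wb (ltnW ltw)); rewrite ltnn.
  - by move=> /(_ erefl); rewrite ltnNge ltnW.
have ne : e (rev_ord a) != e (rev_ord b) by rewrite ea eB.
have card' := etrans (card_swap_state a b e) ek.
rewrite (canon_capcup C eb ea eB) -cap_Seq_inv //.
have eS : Seq_inv k T t (canon C (swap_state a b e)) = t (
     \sum_(e' : state n | #|[set i | e' i]| == k)
       canon C (swap_state a b e) e' *: T (seq_perm k e')) 1 by rewrite Seq_invE.
have lw' : len (seq_perm k (swap_state a b e)) = m.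
  rewrite seq_perm_swap //; apply: succn_inj; rewrite -lw.
  rewrite -(len_tpermM eb) ?mulgA ?tperm2 ?mul1g //.
  by rewrite !permM tpermL tpermR.
have := IHm _ lw' card'; rewrite {}eS => IH.
rewrite (tensor_scale ht) hbarM rmorphM /= barH_cap ?tperm_simple //.
by rewrite -!(tensor_scale ht) -hbarM IH.
Qed.

End BarInvariance.

(** * Diagrams and transversals *)

Section Diagram.
Variables (n : nat) (D : diagram n).
Implicit Types (i j : 'I_n) (S : {set 'I_n}).

Definition partner i : 'I_n := if link D (inr i) is inr j then j else i.

Definition linked i : bool := if link D (inr i) is inr _ then true else false.

Lemma partnerP i j : link D (inr i) = inr j ->
  [/\ link D (inr j) = inr i, i != j, linked i, partner i = j & partner j = i].
Proof.
move=> e; have e' : link D (inr j) = inr i by rewrite -e linkK.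
split=> //; rewrite /linked /partner ?e ?e' //.
by apply/eqP => eij; apply: (@link_neq n D (inr i)); rewrite e eij.
Qed.

Lemma linkedP i : linked i -> link D (inr i) = inr (partner i).
Proof. by rewrite /linked /partner; case: (link D _). Qed.

Lemma top_linksP (L : {set 'I_n}) :
  reflect (exists2 i, linked i & L = [set i; partner i]) (L \in top_links D).
Proof.
rewrite inE; apply: (iffP existsP) => [[i /existsP[j /andP[/eqP-> /eqP]]]|[j]].
  by move/partnerP=> [_ _ li <- _]; exists i.
by move=> lj ->; exists j; apply/existsP; exists (partner j); rewrite linkedP ?eqxx.
Qed.

Lemma top_links_mem (L : {set 'I_n}) i : L \in top_links D -> i \in L ->
  linked i /\ L = [set i; partner i].
Proof.
case/top_linksP=> j lj ->; have [e' _ _ _ pp] := partnerP (linkedP lj).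
rewrite !inE => /orP[/eqP-> //|/eqP->]; rewrite pp setUC; split=> //.
by have [] := partnerP e'.
Qed.

Lemma trivIset_top_links : trivIset (top_links D).
Proof.
apply/trivIsetP => A B PA PB; apply: contraR => /pred0Pn[i /andP[iA iB]].
have [_ ->] := top_links_mem PA iA; have [_ ->] := top_links_mem PB iB.
exact: eqxx.
Qed.

Lemma mem_cover_top_links i : (i \in cover (top_links D)) = linked i.
Proof.
apply/bigcupP/idP => [[L PL iL]|li]; first by have [] := top_links_mem PL iL.
exists [set i; partner i]; last by rewrite !inE eqxx.
by apply/top_linksP; exists i.
Qed.

Lemma card_setI_sum S (L : {set 'I_n}) : #|S :&: L| = (\sum_(i in L) (i \in S))%N.
Proof.
by rewrite setIC -sum1_card big_mkcond [RHS]big_mkcond; apply: eq_bigr => i _;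
  rewrite inE; case: (i \in L); case: (i \in S).
Qed.

Lemma card_setI_link S i : linked i ->
  #|S :&: [set i; partner i]| = ((i \in S) + (partner i \in S))%N.
Proof.
move/linkedP/partnerP=> [_ ni _ _ _].
by rewrite card_setI_sum big_setU1 ?inE // big_set1.
Qed.

Lemma sum_top_links S :
  (\sum_(L in top_links D) #|S :&: L| = #|S :&: cover (top_links D)|)%N.
Proof.
rewrite card_setI_sum (big_trivIset _ trivIset_top_links).
by apply: eq_bigr => L _; rewrite card_setI_sum.
Qed.

(** The numbers of elements of S on the links add up to the number of elements of S
    on linked vertices.  As each of them is 1, the condition on the cardinal of S
    says that all elements of S are linked. *)
Lemma transversalsP S :
  reflect ((forall i, i \in S -> linked i) /\
           forall i, linked i -> (partner i \in S) = (i \notin S))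
          (S \in transversals D).
Proof.
rewrite inE; apply: (iffP andP) => [[/eqP cS /forall_inP oneL]|[subS oneS]].
  have cov : S \subset cover (top_links D).
    suff <- : S :&: cover (top_links D) = S by apply: subsetIr.
    apply/eqP; rewrite eqEcard subsetIl /= cS -sum_top_links -sum1_card.
    by apply: leq_sum => L /oneL/eqP->.
  split=> [i iS|i li]; first by rewrite -mem_cover_top_links (subsetP cov).
  have := oneL [set i; partner i]; rewrite card_setI_link //.
  have -> : [set i; partner i] \in top_links D by apply/top_linksP; exists i.
  by move/(_ isT); do 2!case: (_ \in S).
have oneL : forall L, L \in top_links D -> #|S :&: L| == 1%N.
  move=> _ /top_linksP[i li ->]; rewrite card_setI_link // oneS //.
  by case: (i \in S).
split; last by apply/forall_inP.
have -> : S = S :&: cover (top_links D).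
  by apply/esym/setIidPl/subsetP => i /subS; rewrite mem_cover_top_links.
rewrite -sum_top_links -sum1_card; apply/eqP; apply: eq_bigr => L /oneL.
by move/eqP->.
Qed.

Definition max_transversal : {set 'I_n} := [set i | (partner i < i)%N].

Definition min_ends S : {set 'I_n} := [set i in S | (i < partner i)%N].

Lemma unlinked_partner i : ~~ linked i -> partner i = i.
Proof. by rewrite /linked /partner; case: (link D _). Qed.

Lemma linked_partner i : linked i ->
  [/\ linked (partner i), partner i != i & partner (partner i) = i].
Proof.
move/linkedP/partnerP=> [e ni _ _ pp]; rewrite eq_sym; split=> //.
by have [] := partnerP e.
Qed.

Lemma max_transversalP : max_transversal \in transversals D.
Proof.
apply/transversalsP; split=> i; rewrite !inE.
  by move=> lti; apply/negPn/negP => /unlinked_partner e; rewrite e ltnn in lti.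
move=> li; have [_ ni ->] := linked_partner li.
by move: ni; rewrite -val_eqE /=; lia.
Qed.

(** A link is determined by its smaller end. *)
Lemma cnt_min_ends S : S \in transversals D -> cnt D S = #|min_ends S|.
Proof.
move=> /transversalsP[subS oneS]; rewrite /cnt.
have inj : {in min_ends S &, injective (fun i => [set i; partner i])}.
  move=> i j; rewrite !inE => /andP[_ lti] /andP[_ ltj] /setP e.
  have := e i; have := e j; rewrite !inE !eqxx /=.
  case: eqP => [->//|_] /= /eqP ej; case: eqP => [//|_] /= /esym/eqP ei.
  by move: lti ltj; rewrite -ej -ei => /ltn_trans h /h; rewrite ltnn.
rewrite -(card_in_imset inj); apply: eq_card => L; rewrite inE.
apply/andP/imsetP => [[PL /existsP[i /andP[iL /andP[/forall_inP mini /eqP SL]]]]|].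
  have [li eL] := top_links_mem PL iL; exists i => //; rewrite inE.
  have : i \in S :&: L by rewrite SL inE.
  rewrite inE => /andP[-> _] /=; have := mini (partner i).
  rewrite eL !inE eqxx orbT => /(_ isT).
  by have [_ ni _] := linked_partner li; move: ni; rewrite -val_eqE /=; lia.
case=> i; rewrite inE => /andP[iS lti] ->; have li := subS i iS.
split; first by apply/top_linksP; exists i.
apply/existsP; exists i; rewrite !inE eqxx /=; apply/andP; split.
  apply/forall_inP => j; rewrite !inE => /orP[] /eqP-> //; exact: ltnW.
apply/eqP/setP => j; rewrite !inE; case: eqP => [->|_] /=; first by rewrite iS.
by case: eqP => [->|_]; rewrite ?andbF // oneS // iS.
Qed.

Variable k : nat.
Hypothesis hk : (k <= n)%N.
Hypothesis hD : admissible k D.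

Lemma vstateE S i : vstate k D S i =
  if link D (inr i) is inl b then leftmost k b else i \notin S.
Proof. by rewrite ffunE. Qed.

Lemma vstate_linked S i : linked i -> vstate k D S i = (i \notin S).
Proof. by move/linkedP => e; rewrite vstateE e. Qed.

Lemma vstate_unlinked S S' i : ~~ linked i -> vstate k D S i = vstate k D S' i.
Proof. by rewrite !vstateE /linked; case: (link D _). Qed.

Lemma card_leftmost : #|[set b : 'I_n | leftmost k b]| = k.
Proof.
rewrite -(card_preimset _ rev_ord_inj).
have -> : @rev_ord n @^-1: [set b : 'I_n | leftmost k b] = [set b : 'I_n | (b < k)%N].
  by apply/setP=> b; rewrite !inE /leftmost /=; have := ltn_ord b; lia.
by rewrite -sum1dep_card (big_ord_narrow hk) sum1_card card_ord.
Qed.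

(** Give a bottom vertex the sign - if it is one of the k leftmost, and reverse
    the signs of the top vertices.  Then every link has ends of opposite signs,
    so half of the 2n vertices carry the sign -. *)
Lemma card_vstate S : S \in transversals D -> #|[set i | vstate k D S i]| = k.
Proof.
move=> /transversalsP[_ oneS].
pose sg (v : vertex n) :=
  match v with inl b => leftmost k b | inr i => ~~ vstate k D S i end.
have flip v : sg (link D v) = ~~ sg v.
  case: v => [b|i]; case e: (link D _) => [b'|j] /=.
  - by have := hD e; case: (leftmost k b); case: (leftmost k b').
  - by rewrite vstateE -e linkK.
  - by rewrite vstateE e negbK.
  have [_ _ li <- _] := partnerP e.
  rewrite !vstate_linked ?oneS ?negbK //.
  by have [] := linked_partner li.
have inj : injective (link D) := inv_inj (linkK D).
have half : #|[set v | sg v]| = #|[set v | ~~ sg v]|.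
  rewrite -(card_preimset _ inj); apply: eq_card => v.
  by rewrite !inE flip.
have card_sum (P : pred (vertex n)) : #|[set v | P v]| =
    (#|[set b | P (inl b)]| + #|[set i | P (inr i)]|)%N.
  by rewrite -!sum1dep_card big_sumType.
rewrite !card_sum /= in half.
have := cardsC [set b : 'I_n | leftmost k b].
have := cardsC [set i | vstate k D S i].
have eC (P : pred 'I_n) : ~: [set i | P i] = [set i | ~~ P i].
  by apply/setP=> i; rewrite !inE.
rewrite !eC card_ord card_leftmost; rewrite card_leftmost in half.
have -> : #|[set i | vstate k D S i]| = #|[set i | ~~ ~~ vstate k D S i]|.
  by apply: eq_card => i; rewrite !inE negbK.
have nat_half (A B L : nat) :
    (k + B = L + A -> A + B = n -> k + L = n -> A = k)%N by lia.
exact: nat_half half.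
Qed.

Section Expansion.
Variable C : fieldType.
Let K := ratfun C.
Let q : K := qvar.

(** The factors of the coefficient of f in the tensor product of the cup vectors
    of D and of its unmatched signs.  The factor of a link is attached to its
    smaller end, which is the right one. *)
Definition link_factor (f : state n) i : K :=
  if linked i then
    if (i < partner i)%N then arc_weight q (f (partner i)) (f i) else 1
  else (f i == vstate k D max_transversal i)%:R.

Lemma sgnE S : S \in transversals D ->
  sgn C D S = \prod_i (if i \in min_ends S then - q^-1 else 1).
Proof.
by move=> TS; rewrite /sgn cnt_min_ends // -big_mkcond prodr_const.
Qed.

(** Only one transversal can contribute to the coefficient of f: the set of linked
    vertices where f has +. *)
Lemma prod_link_factor f :
  \prod_i link_factor f i =
  (\sum_(S in transversals D) sgn C D S *: vI C k D S) f.
Proof.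
pose Sf := [set i | linked i && ~~ f i].
have -> : (\sum_(S in transversals D) sgn C D S *: vI C k D S) f =
    \sum_(S in transversals D) sgn C D S * (f == vstate k D S)%:R.
  elim/big_rec2: _ => [|S y x _ <-]; first by rewrite ffunE.
  by rewrite !ffunE.
have eqSf S : S \in transversals D -> vstate k D S = f -> S = Sf.
  move=> /transversalsP[subS _] ef; apply/setP=> i; rewrite inE -ef.
  case li: (linked i); first by rewrite vstate_linked // negbK.
  by apply: contraFF li => /subS.
have [/andP[TS /eqP ef]|nS] := boolP ((Sf \in transversals D) && (f == vstate k D Sf)).
  rewrite (bigD1 Sf) //= -ef eqxx mulr1 [X in _ + X]big1 ?addr0 => [|S /andP[TS' nS]].
    rewrite sgnE //; apply: eq_bigr => i _.
    rewrite /link_factor !inE /arc_weight; case: ifP => li /=; last first.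
      by rewrite {1}ef (vstate_unlinked _ max_transversal) ?li // eqxx.
    have [lp _ _] := linked_partner li; have /transversalsP[_ oneS] := TS.
    have := oneS i li; rewrite !inE lp li /= => /(congr1 negb); rewrite !negbK.
    by move=> ->; case: (f i); rewrite /= ?andbF ?if_same.
  by case: eqP => [/esym/(eqSf _ TS') eS|]; [rewrite eS eqxx in nS | rewrite mulr0].
rewrite [RHS]big1 => [|S TS]; last first.
  case: eqP => [/esym ef|]; last by rewrite mulr0.
  have eS := eqSf S TS ef; case/negP: nS.
  by rewrite -eS TS ef eqxx.
apply/eqP; rewrite prodf_seq_eq0; apply: contraR nS => /hasPn nz.
have {}nz i : link_factor f i != 0 by apply: nz; rewrite mem_index_enum.
have flip i : linked i -> f (partner i) = ~~ f i.
  move=> li; have [lp np pp] := linked_partner li.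
  have [lt|gt|/val_inj e] := ltngtP i (partner i); last by rewrite -e eqxx in np.
    have := nz i; rewrite /link_factor li lt /arc_weight.
    by case: (f i); case: (f _) => //=; rewrite eqxx.
  have := nz (partner i); rewrite /link_factor lp pp gt /arc_weight.
  by case: (f i); case: (f _) => //=; rewrite eqxx.
have TS : Sf \in transversals D.
  apply/transversalsP; split=> i; first by rewrite inE => /andP[].
  by move=> li; have [lp _ _] := linked_partner li; rewrite !inE lp li flip.
rewrite TS; apply/eqP/ffunP=> i; have [li|nli] := boolP (linked i).
  by rewrite vstate_linked // inE li negbK.
rewrite (vstate_unlinked _ max_transversal) //.
have := nz i; rewrite /link_factor (negbTE nli).
by case: (f i =P _) => [->|_] //=; rewrite eqxx.
Qed.

Lemma bdpos_top (p : 'I_n) : bdpos (inr (rev_ord p) : vertex n) = (n + p)%N.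
Proof. by rewrite /bdpos /=; have := ltn_ord p; lia. Qed.

(** The top links of D are the matching of parentheses of the word of I0. *)
Lemma canon_link_factor f :
  canon C (vstate k D max_transversal) f = \prod_i link_factor f i.
Proof.
rewrite ffunE; set e := vstate k D max_transversal.
pose pt (p : 'I_n) :=
  if linked (rev_ord p) then Some (rev_ord (partner (rev_ord p))) else None.
have ptE p r : pt p = Some r ->
    linked (rev_ord p) /\ partner (rev_ord p) = rev_ord r.
  by rewrite /pt; case: ifP => // li [<-]; rewrite rev_ordK.
have ptN p : pt p = None -> ~~ linked (rev_ord p).
  by rewrite /pt; case: ifP.
rewrite (@stack_weight_arcs _ q n (fun p => e (rev_ord p))
           (fun p => f (rev_ord p)) pt); first last.
- move=> p r /ptN np /ptN nr ltpr; rewrite /e !vstateE.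
  move: np nr; rewrite /linked.
  case ep: (link D _) => [b|//] _; case er: (link D _) => [b'|//] _.
  have := @link_noncrossing n D (inl b) (inl b').
  rewrite -ep -er !linkK !bdpos_top ep er /= /leftmost => nx.
  have nb : b <> b' :> nat.
    move=> /val_inj eb; move: ltpr.
    have : inr (rev_ord p) = inr (rev_ord r) :> vertex n.
      by apply: (inv_inj (linkK D)); rewrite ep er eb.
    by case=> epr; have := ltn_ord p; have := ltn_ord r; lia.
  by have := ltn_ord b; have := ltn_ord b'; lia.
- move=> p r i /ptE[lp ep] /andP[ltpi ltir].
  have elp := linkedP lp; rewrite ep in elp.
  have nx1 := @link_noncrossing n D (inr (rev_ord p)) (inr (rev_ord i)).
  have nx2 := @link_noncrossing n D (link D (inr (rev_ord i))) (inr (rev_ord p)).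
  move: nx1 nx2; rewrite linkK elp !bdpos_top.
  case ei: (link D (inr (rev_ord i))) => [b|j].
    by rewrite /= => _; have := ltn_ord b; lia.
  have [_ _ li pi _] := partnerP ei.
  rewrite -(rev_ordK j) bdpos_top => nx1 nx2.
  exists (rev_ord j); first by rewrite /pt li pi.
  have link_inj x y : link D (inr (rev_ord x)) = link D (inr (rev_ord y)) -> x = y.
    move/(inv_inj (linkK D)) => -[exy]; apply: ord_inj.
    by have := ltn_ord x; have := ltn_ord y; lia.
  have njr : rev_ord j <> r :> nat.
    move=> /val_inj ej; have epi : p = i.
      by apply: link_inj; rewrite elp ei -ej rev_ordK.
    by rewrite epi ltnn in ltpi.
  have njp : rev_ord j <> p :> nat.
    move=> /val_inj ej; have eri : r = i.
      by apply: link_inj; rewrite ei -elp linkK -ej rev_ordK.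
    by rewrite eri ltnn in ltir.
  by move: nx1 nx2 njr njp ltpi ltir; move: (rev_ord j) => j'; lia.
- move=> p r /ptE[lp ep]; have [lr nrp er] := linked_partner lp.
  rewrite ep in lr nrp er; rewrite /pt lr er rev_ordK; split=> //.
    by apply: contra nrp => /eqP->.
  rewrite /e vstate_linked // inE ep /=.
  move: nrp; rewrite -val_eqE /=; have := ltn_ord p; have := ltn_ord r; lia.
rewrite (reindex_inj rev_ord_inj) /=; apply: eq_bigr => i _.
rewrite /pt rev_ordK /link_factor; case: ifP => // _.
rewrite rev_ordK /=.
have -> : (n - (partner i).+1 < n - i.+1)%N = (i < partner i)%N.
  by have := ltn_ord i; have := ltn_ord (partner i); lia.
by [].
Qed.

End Expansion.
End Diagram.

(** * The canonical basis element of a diagram *)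

Lemma min_ends_max_transversal n (D : diagram n) :
  min_ends D (max_transversal D) = set0.
Proof. by apply/setP=> i; rewrite !inE; case: ltngtP. Qed.

(** A transversal without the smaller end of any link takes the larger end of each. *)
Lemma max_transversal_uniq n (D : diagram n) (S : {set 'I_n}) :
  S \in transversals D -> min_ends D S = set0 -> S = max_transversal D.
Proof.
move=> /transversalsP[subS oneS] /setP m0; apply/setP=> i; rewrite inE.
apply/idP/idP => [iS|lti].
  have [_ ni _] := linked_partner (subS i iS); move: (m0 i); rewrite !inE iS /=.
  by move: ni; rewrite -val_eqE /=; lia.
apply/negPn/negP => niS; have li : linked D i.
  by apply/negPn/negP => /unlinked_partner e; rewrite e ltnn in lti.
have [_ _ pp] := linked_partner li.
by move: (m0 (partner D i)); rewrite !inE oneS // niS pp lti.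
Qed.

Section Main.
Variables (C : fieldType) (n k : nat).
Let K := ratfun C.
Let q : K := qvar.
Variables (H : falgType K) (T : 'S_n -> H).
Hypothesis hT : is_hecke_basis T.
Variables (act : H -> K -> K) (M : lmodType H) (t : H -> K -> M).
Hypotheses (hact : is_triv_action k T act)
  (ht : is_tensor (mem (heckeJ k T)) act t).
Variables (bar : {rmorphism K -> K}) (barH : {rmorphism H -> H}).
Hypotheses (hbar : is_bar bar) (hbarH : is_hecke_bar bar T barH).
Variable barM : {additive M -> M}.
Hypothesis hbarM : forall h, barM (t h 1) = t (barH h) 1.

(** This sign lies in q^-1 Z[q^-1] unless d is 0, whereas 1 is bar-invariant. *)
Lemma sign_power_eq1 d : (- q^-1) ^+ d = 1 -> d = 0%N.
Proof.
case: d => // d e1; have := bar_qinvZ hbar (in_qinvZ_sign C (ltn0Sn d)).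
rewrite e1 rmorph1 => /(_ erefl)/eqP; by rewrite oner_eq0.
Qed.

Lemma canonical_uniq w X Y : is_canonical k T t barM w X ->
  is_canonical k T t barM w Y -> X = Y.
Proof.
case=> bX [c qc eX] [bY [c' qc' eY]].
have eXY : X - Y = \sum_(y in minrep n k) ((c y - c' y)%:A : H) *: stdM T t y.
  rewrite eX eY opprD addrACA subrr add0r -sumrB; apply: eq_bigr => y _.
  by rewrite !scalerBl.
apply/eqP; rewrite -subr_eq0 eXY; apply/eqP.
apply: (bar_lin_indep hT hact ht hbar hbarH hbarM) => [y my|].
  by apply: in_qinvZD; [exact: qc | apply: in_qinvZN; exact: qc'].
by rewrite -eXY raddfB /= bX bY.
Qed.

Variable D : diagram n.
Hypotheses (hk : (k <= n)%N) (hD : admissible k D).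

Lemma diagram_canonical :
  is_canonical k T t barM (seq_perm k (vstate k D (max_transversal D)))
    (\sum_(I in transversals D)
       ((sgn C D I)%:A : H) *: Seq_inv k T t (vI C k D I)).
Proof.
set I0 := max_transversal D; have TI0 : I0 \in transversals D := max_transversalP D.
pose w I := seq_perm k (vstate k D I).
split.
  rewrite (Seq_inv_sum ht).
  have -> : \sum_(I in transversals D) sgn C D I *: vI C k D I =
      canon C (vstate k D I0).
    by apply/ffunP=> f; rewrite canon_link_factor // -prod_link_factor.
  by apply: (bar_canon hT hact ht hbar hbarH hbarM); apply: card_vstate.
exists (fun y => \sum_(I in transversals D | (I != I0) && (w I == y)) sgn C D I).
  move=> y _; elim/big_ind: _ => [||I /andP[TI /andP[nI _]]].
  - exact: in_qinvZ0.
  - exact: in_qinvZD.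
  apply: in_qinvZ_sign; rewrite lt0n (cnt_min_ends TI); apply: contra nI.
  by rewrite cards_eq0 => /eqP/(max_transversal_uniq TI)->.
rewrite (bigD1 I0) //=; congr (_ + _).
  rewrite (Seq_inv_stdV ht) ?card_vstate // /sgn cnt_min_ends //.
  by rewrite min_ends_max_transversal cards0 expr0 !scale1r.
rewrite (partition_big w (mem (minrep n k))) /=; last first.
  move=> I /andP[TI _]; apply/minrepP.
  by have [] := seq_permP (card_vstate hk hD TI).
apply: eq_bigr => y my; rewrite scaler_suml scaler_suml.
apply: eq_big => [I|I /andP[/andP[TI _] /eqP <-]]; first by rewrite andbA.
by rewrite (Seq_inv_stdV ht) ?card_vstate.
Qed.

End Main.

Theorem corollary8p9 (R : realType) (n k : nat) (hk : (k <= n)%N)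
    (bar : {rmorphism ratfun R[i] -> ratfun R[i]}) (hbar : is_bar bar)
    (H : falgType (ratfun R[i])) (T : 'S_n -> H) (hT : is_hecke_basis T)
    (barH : {rmorphism H -> H}) (hbarH : is_hecke_bar bar T barH)
    (act : H -> ratfun R[i] -> ratfun R[i]) (hact : is_triv_action k T act)
    (M : lmodType H) (t : H -> ratfun R[i] -> M)
    (ht : is_tensor (mem (heckeJ k T)) act t)
    (barM : {additive M -> M})
    (hbarM : forall h, barM (t h 1) = t (barH h) 1)
    (D : diagram n) (hD : admissible k D) :
  exists (I0 : {set 'I_n}) (w : 'S_n),
    [/\ unique (fun I => I \in transversals D /\ sgn R[i] D I = 1) I0,
        unique (fun x => x \in minrep n k /\
                         Seq_inv k T t (vI R[i] k D I0) = stdM T t x) w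
      & unique (is_canonical k T t barM w)
          (\sum_(I in transversals D)
             ((sgn R[i] D I)%:A : H) *: Seq_inv k T t (vI R[i] k D I))].
Proof.
have TI0 := max_transversalP D; have cI0 := card_vstate hk hD TI0.
exists (max_transversal D), (seq_perm k (vstate k D (max_transversal D))).
have mw : seq_perm k (vstate k D (max_transversal D)) \in minrep n k.
  by apply/minrepP; have [] := seq_permP cI0.
have can := diagram_canonical hT hact ht hbar hbarH hbarM hk hD.
split; split.
- split=> //; rewrite /sgn cnt_min_ends // min_ends_max_transversal cards0.
  exact: expr0.
- move=> I [TI /(sign_power_eq1 hbar)]; rewrite cnt_min_ends // => /eqP.
  by rewrite cards_eq0 => /eqP/(max_transversal_uniq TI).
- by split=> //; rewrite /vI (Seq_inv_stdV ht).
- move=> x [mx]; rewrite /vI (Seq_inv_stdV ht) //.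
  exact: (stdM_inj hT hact ht).
- exact: can.
by move=> X; apply: (canonical_uniq hT hact ht hbar hbarH hbarM can).
Qed.
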